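(* Let $E\subset\mathbb{C}^N$ be a nonpluripolar compact set, $w$ an admissible weight function on $E$, and $\mu$ a finite positive Borel measure with support in $E$ such that $(E,w,\mu)$ satisfies a Bernstein–Markov inequality for weighted polynomials. For $d=1,2,\dots$ let $$Z_d=Z_d(E,w,\mu):=\int_{E^{m_d}}|VDM(\lambda^{(1)},\dots,\lambda^{(m_d)})|^2\,w(\lambda^{(1)})^{2d}\cdots w(\lambda^{(m_d)})^{2d}\,d\mu(\lambda^{(1)})\cdots d\mu(\lambda^{(m_d)}).$$ Then $$\lim_{d\to\infty}Z_d^{1/(2l_d)}=\delta^w(E).$$
   Context: Let $e_1(z),e_2(z),\dots$ be a listing of the monomials $e_i(z)=z^{\alpha(i)}$ in $\mathbb{C}^N$, using a lexicographic ordering on the multiindices $\alpha(i)\in\{0,1,2,\dots\}^N$ but with $\deg e_i=|\alpha(i)|$ nondecreasing. $m_d=\binom{N+d}{d}$ is the number of monomials of degree at most $d$ in $N$ variables and $l_d=N\binom{N+d}{N+1}$ is the sum of their degrees. $VDM(\zeta_1,\dots,\zeta_n)=\det[e_i(\zeta_j)]_{i,j=1,\dots,n}$. An admissible weight function on $E$ is a nonnegative upper semicontinuous function $w$ on $E$ with $\{z\in E:w(z)>0\}$ nonpluripolar. The weighted transfinite diameter is $$\delta^w(E):=\lim_{d\to\infty}\Bigl[\max_{\lambda^{(1)},\dots,\lambda^{(m_d)}\in E}|VDM(\lambda^{(1)},\dots,\lambda^{(m_d)})|\,w(\lambda^{(1)})^d\cdots w(\lambda^{(m_d)})^d\Bigr]^{1/l_d}$$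 (the limit exists). $(E,w,\mu)$ satisfies a Bernstein–Markov inequality for weighted polynomials if for every $\epsilon>0$ there is a constant $M=M(\epsilon)$ such that for all $n$ and all holomorphic polynomials $p_n$ of degree at most $n$, $\|w^np_n\|_E\le M(1+\epsilon)^n\|w^np_n\|_{L^2(\mu)}$, where $\|\cdot\|_E$ is the sup norm on $E$. *)

(* Defs.v *)
From HB Require Import structures.
From mathcomp Require Import all_boot all_order all_algebra.
From mathcomp Require Import complex.
(* the notations of mpoly clash with those of mathcomp-analysis *)
From mathcomp Require Import -(notations) mpoly.
From mathcomp Require Import all_classical all_reals all_analysis.

Set Implicit Arguments.
Unset Strict Implicit.
Unset Printing Implicit Defensive.

Import Order.TTheory GRing.Theory Num.Theory numFieldNormedType.Exports.

Local Open Scope classical_set_scope.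
Local Open Scope ring_scope.
Local Open Scope complex_scope.

(* R[i]^o is the field R[i] seen as a normed space over itself; this is what
   gives C^N its usual (product) topology. *)
Notation Cspace R N := 'rV[(R[i])^o]_N.

Notation borelC R N := (g_sigma_algebraType (@open (Cspace R N))).

Notation cabs := ComplexField.Normc.normc.

Definition upper_semicontinuous_on (R : realType) (T : topologicalType)
    (A : set T) (f : T -> \bar R) : Prop :=
  forall x, A x -> forall c : R, (f x < c%:E)%E ->
    \forall y \near within A (nbhs x), (f y < c%:E)%E.

(* The function identically -oo is plurisubharmonic with this definition. *)
Definition plurisubharmonic (R : realType) (N : nat)
    (u : Cspace R N -> \bar R) : Prop :=
  [/\ forall z, (u z < +oo)%E,
      upper_semicontinuous_on setT u &
      forall a b : Cspace R N,
        (u a <= (((2 * pi)^-1)%R)%:E *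
          \int[@lebesgue_measure R]_(t in `[0%R, (2 * pi)%R])
             u (a + ((cos t +i* sin t) : (R[i])^o) *: b)%R)%E].

Definition pluripolar (R : realType) (N : nat) (A : set (Cspace R N)) : Prop :=
  exists u : Cspace R N -> \bar R,
    [/\ plurisubharmonic u, exists z, u z <> -oo%E &
        A `<=` [set z | u z = -oo%E]].

Definition admissible_weight (R : realType) (N : nat)
    (E : set (Cspace R N)) (w : Cspace R N -> R) : Prop :=
  [/\ forall z, E z -> 0 <= w z,
      upper_semicontinuous_on E (EFin \o w) &
      ~ pluripolar [set z | E z /\ 0 < w z]].

(* Number of monomials of degree at most d, and sum of their degrees. *)
Definition mdim (N d : nat) : nat := 'C(N + d, d).
Definition ldeg (N d : nat) : nat := (N * 'C(N + d, N.+1))%N.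

(* The order <=%O on multinom N compares degrees first and breaks ties
   lexicographically, so the sorted list of the multi-indices of degree at most
   i is an initial segment of the full listing; for N > 0 it has at least i + 1
   entries.  Indices start at 0: mindex N i is the multi-index alpha(i + 1). *)
Definition mindex (N i : nat) : multinom N :=
  nth (@mnm0 N)
    (sort <=%O [seq bmnm m | m <- enum {: bmultinom N i.+1}]) i.

Definition monom (R : realType) (N i : nat) (z : Cspace R N) : R[i] :=
  \prod_(k < N) (z ord0 k : R[i]) ^+ (fun_of_multinom (mindex N i) k).

Definition VDM (R : realType) (N n : nat) (zeta : n.-tuple (Cspace R N)) : R[i] :=
  \det (\matrix_(i < n, j < n) monom i (tnth zeta j)).

Definition weighted_VDM (R : realType) (N : nat) (w : Cspace R N -> R) (d : nat)
    (lam : (mdim N d).-tuple (Cspace R N)) : R :=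
  cabs (VDM lam) * \prod_(j < mdim N d) w (tnth lam j) ^+ d.

(* The supremum is a maximum when E is a nonempty compact set and w is
   nonnegative and upper semicontinuous on E. *)
Definition max_weighted_VDM (R : realType) (N : nat) (E : set (Cspace R N))
    (w : Cspace R N -> R) (d : nat) : R :=
  sup [set weighted_VDM w lam
      | lam in [set lam : (mdim N d).-tuple (Cspace R N)
               | forall j, E (tnth lam j)]].

Definition weighted_transfinite_diameter (R : realType) (N : nat)
    (E : set (Cspace R N)) (w : Cspace R N -> R) : R :=
  lim ((max_weighted_VDM E w d `^ ((ldeg N d)%:R^-1)) @[d --> \oo]).

Definition measure_support (R : realType) (N : nat)
    (mu : set (borelC R N) -> \bar R) : set (Cspace R N) :=
  [set z | forall U : set (Cspace R N), open_nbhs z U -> (0 < mu U)%E].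

(* w^n p is extended by 0 outside E, where w has no meaning. *)
Definition bernstein_markov (R : realType) (N : nat) (E : set (Cspace R N))
    (w : Cspace R N -> R)
    (mu : {finite_measure set (borelC R N) -> \bar R}) : Prop :=
  forall eps : R, 0 < eps -> exists M : R,
    forall (n : nat) (p : mpoly N R[i]),
      (mmeasure (@mdeg N) p <= n.+1)%N ->
      let wp z := (w z ^+ n * cabs (meval (fun k => z ord0 k : R[i]) p))%:E
      in
      (ereal_sup [set wp z | z in E]
         <= ((M * (1 + eps) ^+ n)%R)%:E * 'N[mu]_2%:E[wp \_ E])%E.

(* Integral over E^n with respect to the n-fold product of mu, written as an
   iterated integral; by Tonelli's theorem they agree for measurable f >= 0. *)
Fixpoint iterated_integral (R : realType) (N : nat)
    (mu : {finite_measure set (borelC R N) -> \bar R}) (E : set (Cspace R N))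
    (n : nat) : (n.-tuple (Cspace R N) -> \bar R) -> \bar R :=
  match n with
  | 0%N => fun f => f [tuple]
  | n'.+1 => fun f =>
      (\int[mu]_(x in E)
         iterated_integral mu E (fun t : n'.-tuple (Cspace R N) =>
           f [tuple of (x : Cspace R N) :: t]))%E
  end.

Definition Zint (R : realType) (N : nat) (E : set (Cspace R N))
    (w : Cspace R N -> R)
    (mu : {finite_measure set (borelC R N) -> \bar R}) (d : nat) : \bar R :=
  iterated_integral mu E (fun lam : (mdim N d).-tuple (Cspace R N) =>
    (cabs (VDM lam) ^+ 2 * \prod_(j < mdim N d) w (tnth lam j) ^+ (2 * d)%N)%:E).

(* Main.v *)
(** Idea.  On n points of E let W_n be the largest value of |VDM| w^d ... w^d, and
    for a multi-index m let Y(d, m) be the least sup norm on E of w^d p over the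
    polynomials p with leading term z^m.  Expanding a Vandermonde determinant along
    its last row gives Y W_n <= W_(n+1) <= (n+1) Y W_n with Y = Y(d, alpha(n+1)), so
    the maximum over E^(m_d) equals the product of all Y(d, m), |m| <= d, up to a
    factor at most m_d!, which disappears after taking the l_d-th root.

    Y is submultiplicative in (d, m), and Y(d, m) <= C^d.  Let a_d be the product of
    the y(d, m) = Y(d, m) / C^d <= 1.  If q (k + N) <= d, then for |b| <= k and s in
    [0, q)^N the multi-indices q b + s are distinct and of degree at most d, and
    y(d, q b + s) <= y(k, b)^q; hence a_d <= a_k^(q^(N+1)).  As in Fekete's lemma,
    a_d^(1/l_d) converges to an infimum over k.  Values 0 are allowed, so no lower
    bound on Y is needed: the weighted transfinite diameter is the limit of its
    defining sequence for every compact E and bounded w.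

    Finally, Z_d is at most the squared maximum times mu(C^N)^(m_d), and applying the
    Bernstein-Markov inequality to one variable of the determinant at a time bounds
    the squared maximum by (M (1 + eps)^d)^(2 m_d) Z_d; both factors are harmless
    because m_d / l_d = (N + 1) / (N d). *)

Require Import Defs.
From HB Require Import structures.
From mathcomp Require Import all_boot all_order all_algebra.
From mathcomp Require Import complex.
From mathcomp Require Import -(notations) mpoly.
From mathcomp Require Import all_classical all_reals all_analysis.
From mathcomp Require Import zify ring lra.

Set Implicit Arguments.
Unset Strict Implicit.
Unset Printing Implicit Defensive.

Import Order.TTheory GRing.Theory Num.Theory numFieldNormedType.Exports.

Local Open Scope classical_set_scope.
Local Open Scope ring_scope.

(** * The graded listing of multi-indices *)

(** Exponent vectors of degree at most [d] correspond to the [N]-tuples over ['I_d.+1] with sum at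
    most [d], whose number is a known binomial coefficient. *)
Lemma card_bmultinom (N d : nat) : #|{: bmultinom N d.+1}| = mdim N d.
Proof.
have sm (m : bmultinom N d.+1) i : (fun_of_multinom m i <= d)%N.
  rewrite -ltnS (leq_ltn_trans _ (bmdeg m))// mdegE (bigD1 i)//=.
  exact: leq_addr.
pose g (m : bmultinom N d.+1) : N.-tuple 'I_d.+1 :=
  [tuple inord (fun_of_multinom m i) | i < N].
have gi : injective g.
  move=> m m' mm; apply/val_inj/mnmP => i.
  move/(congr1 (fun t => val (tnth t i))): mm.
  by rewrite !tnth_mktuple /= !inordK// ltnS sm.
rewrite /mdim -bin_sub ?leq_addl// addnK -card_partial_ord_partitions.
rewrite -(card_imset _ gi); apply: eq_card => t; rewrite [RHS]inE big_tuple.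
apply/imsetP/idP => [[m _ ->]|td].
  under eq_bigr do rewrite tnth_mktuple inordK ?ltnS ?sm//.
  by rewrite -mdegE -ltnS bmdeg.
have md : (mdeg (Multinom (map_tuple val t)) < d.+1)%N.
  by rewrite ltnS mdegE; under eq_bigr do rewrite multinomE tnth_map.
exists (BMultinom md) => //; apply: eq_from_tnth => i.
apply/val_inj; rewrite tnth_mktuple /= inordK ?ltnS ?(sm (BMultinom md))//.
by rewrite multinomE tnth_map.
Qed.

(** [mindex N i] reads [graded_seq N i]; with the truncation degree as a parameter, different
    truncations can be compared. *)
Definition graded_seq (N d : nat) : seq (multinom N) :=
  sort <=%O [seq bmnm m | m <- enum {: bmultinom N d.+1}].

Lemma mem_graded_seq N d (m : multinom N) :
  (m \in graded_seq N d) = (mdeg m <= d)%N.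
Proof.
rewrite mem_sort; apply/mapP/idP => [[b _ ->]|md]; first exact: (bmdeg b).
by exists (BMultinom (md : mdeg m < d.+1)%N); rewrite ?mem_enum.
Qed.

Lemma graded_seq_uniq N d : uniq (graded_seq N d).
Proof. by rewrite sort_uniq map_inj_uniq ?enum_uniq//; exact: val_inj. Qed.

Lemma size_graded_seq N d : size (graded_seq N d) = mdim N d.
Proof. by rewrite size_sort size_map -cardE card_bmultinom. Qed.

Lemma graded_seq_sorted N d : sorted <=%O (graded_seq N d).
Proof. by apply: sort_sorted; exact: le_total. Qed.

(** The order compares degrees first, so both sides are sorted; they have the same entries, and
    antisymmetry makes them equal. *)
Lemma graded_seq_prefix N k l : (k <= l)%N ->
  graded_seq N l = graded_seq N k ++ [seq m <- graded_seq N l | k < mdeg m]%N.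
Proof.
move=> kl; apply: (sorted_eq le_trans le_anti).
- exact: graded_seq_sorted.
- rewrite (sorted_pairwise le_trans) pairwise_cat -!(sorted_pairwise le_trans).
  rewrite graded_seq_sorted (sorted_filter le_trans) ?graded_seq_sorted// !andbT.
  apply/allrelP => x y; rewrite mem_graded_seq mem_filter => xk /andP[ky _].
  by apply/ltW/lt_mdeg_ltmc; exact: leq_ltn_trans ky.
- apply: uniq_perm; first exact: graded_seq_uniq.
    rewrite cat_uniq graded_seq_uniq filter_uniq ?graded_seq_uniq// andbT.
    apply/hasPn => x /=; rewrite mem_filter => /andP[+ _].
    by rewrite !(inE, mem_graded_seq) ltnNge.
  move=> m; rewrite mem_cat mem_filter !mem_graded_seq.
  by case: leqP => //= mk; exact: leq_trans kl.
Qed.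

(** For [N > 0] more than [i] multi-indices have degree at most [i], so position [i] lies inside
    both truncations, one of which is a prefix of the other. *)
Lemma mindexE N d i : (0 < N)%N -> (i < mdim N d)%N ->
  mindex N i = nth (@mnm0 N) (graded_seq N d) i.
Proof.
move=> N0 id; rewrite /mindex -/(graded_seq N i).
have ii : (i < mdim N i)%N.
  rewrite /mdim; case: N N0 {id} => // n _; elim: i => [|i IH]; first by rewrite bin0.
  rewrite addnS binS -[i.+2]add1n; apply: leq_add => //.
  by rewrite bin_gt0 addSn ltnS leq_addl.
have [di|/ltnW di] := leqP i d.
  by rewrite (graded_seq_prefix N di) nth_cat size_graded_seq ii.
by rewrite (graded_seq_prefix N di) nth_cat size_graded_seq id.
Qed.

Lemma mdeg_mindex N d i : (0 < N)%N -> (i < mdim N d)%N -> (mdeg (mindex N i) <= d)%N.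
Proof.
by move=> N0 id; rewrite (mindexE N0 id) -mem_graded_seq mem_nth ?size_graded_seq.
Qed.

(** This confines the support of a polynomial with leading monomial [mindex N n] to the first
    [n + 1] monomials. *)
Lemma lt_mindex N d (m : multinom N) i : (0 < N)%N -> (i < mdim N d)%N ->
  (m < mindex N i)%O -> exists2 j, (j < i)%N & m = mindex N j.
Proof.
move=> N0 id lt_m.
have m_in : m \in graded_seq N d.
  rewrite mem_graded_seq (leq_trans _ (mdeg_mindex N0 id))//.
  exact/lemc_mdeg/ltW.
have jd : (index m (graded_seq N d) < mdim N d)%N.
  by rewrite -size_graded_seq index_mem.
exists (index m (graded_seq N d)); last by rewrite (mindexE N0 jd) nth_index.
rewrite ltnNge; apply/negP => ij.
move: lt_m; rewrite ltNge => /negP; apply.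
rewrite (mindexE N0 id) -{1}(nth_index (@mnm0 N) m_in).
have := sorted_leq_nth le_trans le_refl (@mnm0 N) (graded_seq_sorted N d).
by apply => //; rewrite inE size_graded_seq.
Qed.

Lemma mindex_inj N d : (0 < N)%N -> {in gtn (mdim N d) &, injective (mindex N)}.
Proof.
move=> N0 i j id jd; rewrite !(mindexE N0 (d := d))// => /eqP.
by rewrite nth_uniq ?size_graded_seq ?graded_seq_uniq// => /eqP.
Qed.

Lemma prod_mindex (R : comNzRingType) N d (f : multinom N -> R) : (0 < N)%N ->
  \prod_(i < mdim N d) f (mindex N i) = \prod_(m : bmultinom N d.+1) f m.
Proof.
move=> N0; under eq_bigr do rewrite (mindexE N0 (d := d))//.
rewrite -(big_mkord xpredT (fun i => f (nth (@mnm0 N) (graded_seq N d) i))).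
rewrite -size_graded_seq -(big_nth _ xpredT).
rewrite (perm_big _ (permEl (perm_sort _ _))).
by rewrite big_map big_enum.
Qed.

(** * Products of a submultiplicative family *)

(* The remainders [s] in [0, q)^N cost nothing because [y <= 1], and the slack
   [q N <= d - q k] leaves room for their degree. *)
Lemma prod_submul_le (R : realDomainType) (N : nat) (y : nat -> multinom N -> R) :
  (forall d m, 0 <= y d m <= 1) ->
  (forall d d' m m', (mdeg m <= d)%N -> (mdeg m' <= d')%N ->
     y (d + d')%N (mnm_add m m') <= y d m * y d' m') ->
  forall k q d, (q * (k + N) <= d)%N ->
  \prod_(m : bmultinom N d.+1) y d m
    <= (\prod_(m : bmultinom N k.+1) y k m) ^+ (q ^ N.+1).
Proof.
move=> y01 ysub k q d qd.
have y0 e m : 0 <= y e m by case/andP: (y01 e m).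
have y1 e m : y e m <= 1 by case/andP: (y01 e m).
have y_le1 e : \prod_(m : bmultinom N e.+1) y e m <= 1.
  by apply: prodr_ile1 => m _.
case: q qd => [|q'] qd; first by rewrite exp0n// expr0.
set q := q'.+1 in qd *.
pose digits (s : {ffun 'I_N -> 'I_q}) : multinom N := Multinom [tuple s i : nat | i < N].
pose h (bs : bmultinom N k.+1 * {ffun 'I_N -> 'I_q}) : multinom N :=
  mnm_add (mnm_muln bs.1 q) (digits bs.2).
have hE bs i : fun_of_multinom (h bs) i = (fun_of_multinom bs.1 i * q + bs.2 i)%N.
  by rewrite /h mnmDE mulmnE mnmE.
have qkd : (q * k <= d)%N by rewrite (leq_trans _ qd)// leq_mul2l leq_addr orbT.
have deg_digits s : (mdeg (digits s) <= d - q * k)%N.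
  rewrite mdegE (@leq_trans (\sum_(i < N) q)%N)//.
    by apply: leq_sum => i _; rewrite mnmE ltnW.
  by rewrite sum_nat_const card_ord leq_subRL// [(N * _)%N]mulnC -mulnDr.
have degb (b : bmultinom N k.+1) : (mdeg b <= k)%N by rewrite -ltnS bmdeg.
have degh bs : (mdeg (h bs) < d.+1)%N.
  rewrite ltnS mdegD mdegMn -(subnKC qkd) leq_add ?deg_digits//.
  by rewrite mulnC leq_mul2l degb orbT.
pose hb bs : bmultinom N d.+1 := BMultinom (degh bs).
(* Quotient and remainder modulo [q] recover [b] and [s] entrywise. *)
have hb_inj : injective hb.
  move=> [b s] [b' s'] /(congr1 (fun m => bmnm m)) /mnmP hh.
  have e i : fun_of_multinom b i = fun_of_multinom b' i /\ s i = s' i.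
    have := hh i; rewrite !hE /= => e; split.
      by have := congr1 (divn^~ q) e; rewrite !divnMDl// !divn_small ?addn0.
    apply: val_inj.
    by have := congr1 (modn^~ q) e; rewrite !modnMDl !modn_small.
  congr pair; first by apply/val_inj/mnmP => i; case: (e i).
  by apply/ffunP => i; case: (e i).
have ypow b j : (mdeg b <= k)%N -> y (j * k)%N (mnm_muln b j) <= y k b ^+ j.
  move=> bk; elim: j => [|j IH]; first by rewrite expr0 y1.
  rewrite mulSn mulmS exprS (le_trans (ysub _ _ _ _ bk _))//.
    by rewrite mdegMn mulnC leq_mul2l bk orbT.
  exact: ler_wpM2l.
have yh bs : y d (h bs) <= y k bs.1 ^+ q.
  rewrite -{1}(subnKC qkd) (le_trans (ysub _ _ _ _ _ (deg_digits _)))//.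
    by rewrite mdegMn mulnC leq_mul2l degb orbT.
  by rewrite (le_trans (ler_piMr _ _))// ypow.
rewrite (bigID [in hb @: setT])/=.
apply: le_trans (_ : \prod_(m in hb @: setT) y d m <= _).
  by rewrite ler_piMr ?prodr_ge0// prodr_ile1.
rewrite big_imset/=; last by move=> ? ? _ _; exact: hb_inj.
apply: le_trans (_ : \prod_(bs in [set: bmultinom N k.+1 * {ffun 'I_N -> 'I_q}])
    y k bs.1 ^+ q <= _).
  by apply: ler_prod => bs _; rewrite y0 yh.
rewrite (eq_bigl xpredT); last by move=> bs; exact: in_setT.
rewrite -(pair_bigA _ (fun (b : bmultinom N k.+1) _ => y k b ^+ q))/=.
(* Each [b] occurs with [q ^ N] remainders, each time with exponent [q], which gives [q ^ N.+1]. *)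
under eq_bigr do rewrite big_const iter_mulr_1 card_ffun !card_ord -exprM -expnS.
by rewrite prodrXl.
Qed.

(** * Real powers and falling factorials *)

(** At [a = 0] the power is 1 for exponent 0 and 0 otherwise, which is still nonincreasing on
    nonnegative exponents. *)
Lemma ler_powR_exp (R : realType) (a x y : R) :
  0 <= a <= 1 -> 0 <= x -> x <= y -> a `^ y <= a `^ x.
Proof.
move=> /andP[a0 a1] x0 xy; move: a0; rewrite le_eqVlt => /predU1P[<-|a0].
  have [->|xn0] := eqVneq x 0; last first.
    by rewrite powR0 ?powR_ge0// gt_eqF// (lt_le_trans _ xy)// lt_def xn0.
  by rewrite powRr0; have [->|yn0] := eqVneq y 0; rewrite ?powRr0// powR0.
by apply: ger_powR => //; rewrite a0.
Qed.

Lemma cvg_powR_exp_gt0 (R : realType) (a c : R) (u : nat -> R) : 0 < a ->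
  u d @[d --> \oo] --> c -> (a `^ u d) @[d --> \oo] --> a `^ c.
Proof.
move=> a0 uc; have E x : a `^ x = expR (x * ln a) by rewrite /powR gt_eqF.
rewrite E; under eq_fun do rewrite E.
apply: (@cvg_comp _ _ _ (fun d => u d * ln a) expR); last exact: continuous_expR.
by apply: cvgM => //; exact: cvg_cst.
Qed.

(** For [a = 0] the limit [c > 0] makes the exponents eventually positive, and the powers are then
    0. *)
Lemma cvg_powR_exp (R : realType) (a c : R) (u : nat -> R) : 0 < c -> 0 <= a ->
  u d @[d --> \oo] --> c -> (a `^ u d) @[d --> \oo] --> a `^ c.
Proof.
move=> c0; rewrite le_eqVlt => /predU1P[<-|a0] uc; last exact: cvg_powR_exp_gt0.
rewrite powR0 ?gt_eqF//; apply: cvg_near_cst.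
near=> d; rewrite powR0// gt_eqF//; near: d.
exact: cvgr_gt uc _ c0.
Unshelve. all: by end_near. Qed.

Lemma cvg_inv_addn (R : realType) (N : nat) : (0 < N)%N ->
  ((d + N)%:R^-1 : R) @[d --> \oo] --> (0 : R).
Proof.
case: N => // N _.
under eq_fun do rewrite addnS.
by have := @cvg_harmonic R; rewrite -(cvg_shiftn N (@harmonic R)).
Qed.

Lemma ffact_le_expn n k : (n ^_ k <= n ^ k)%N.
Proof.
elim: k n => [|k IH] [|n] //.
rewrite ffactSS expnS leq_mul// (leq_trans (IH _))//.
by case: k {IH} => // k; rewrite leq_exp2r.
Qed.

Lemma expn_le_ffact d N : (d ^ N.+1 <= (d + N) ^_ N.+1)%N.
Proof.
elim: N => [|N IH]; first by rewrite addn0 ffactn1 expn1.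
by rewrite addnS ffactSS expnS leq_mul// -addnS leq_addr.
Qed.

Lemma ldeg_gt0 N d : (0 < N)%N -> (0 < d)%N -> (0 < ldeg N d)%N.
Proof. by move=> N0 d0; rewrite muln_gt0 N0 bin_gt0 -addn1 leq_add2l. Qed.

Lemma ldeg_fact N d : (ldeg N d * N.+1`! = N * (d + N) ^_ N.+1)%N.
Proof. by rewrite /ldeg -mulnA bin_ffact addnC. Qed.

(** * A Fekete-type lemma for roots of order [ldeg N d] *)

Section root_limit.
Variables (R : realType) (N : nat) (a : nat -> R).
Hypothesis N_gt0 : (0 < N)%N.
Hypothesis a01 : forall d, 0 <= a d <= 1.
Hypothesis a_sub : forall k q d, (q * (k + N) <= d)%N -> a d <= a k ^+ (q ^ N.+1).

(* [e k] is the limit of [q ^ (N + 1) / ldeg N d] for [q = d %/ (k + N)]. *)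
Let e k : R := N.+1`!%:R / (N%:R * (k + N)%:R ^+ N.+1).

Let a0 d : 0 <= a d. Proof. by case/andP: (a01 d). Qed.

Let kN_gt0 k : 0 < (k + N)%:R :> R.
Proof. by rewrite ltr0n addn_gt0 N_gt0 orbT. Qed.

Let N0 : 0 < N%:R :> R. Proof. by rewrite ltr0n. Qed.

Let e_gt0 k : 0 < e k.
Proof.
by rewrite divr_gt0 ?mulr_gt0 ?exprn_gt0// ltr0n fact_gt0.
Qed.

Let l_gt0 d : (0 < d)%N -> 0 < (ldeg N d)%:R :> R.
Proof. by move=> d0; rewrite ltr0n ldeg_gt0. Qed.

Let lE d : (ldeg N d)%:R = N%:R * ((d + N) ^_ N.+1)%:R / N.+1`!%:R :> R.
Proof. by rewrite -natrM -ldeg_fact natrM mulfK// pnatr_eq0 -lt0n fact_gt0. Qed.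

(** For [q = d %/ (k + N)], the bounds [q >= d / (k + N) - 1] and
    [(d + N) ^_ N.+1 <= (d + N) ^ N.+1] bound the exponent [q ^ N.+1 / ldeg N d] from below, and
    [a k <= 1] reverses the inequality. Writing the exponent through [1 / (d + N)] makes its limit
    visible. *)
Lemma root_limsup k d : ((k + N) < d)%N ->
  a d `^ (ldeg N d)%:R^-1
   <= a k `^ (N.+1`!%:R / N%:R *
        ((k + N)%:R^-1 - (N%:R / (k + N)%:R + 1) * (d + N)%:R^-1) ^+ N.+1).
Proof.
move=> kd; have d0 : (0 < d)%N by exact: leq_ltn_trans kd.
set q := (d %/ (k + N))%N.
have ad : a d <= a k ^+ (q ^ N.+1) by apply: a_sub; exact: leq_trunc_div.
apply: le_trans (_ : (a k ^+ (q ^ N.+1)) `^ (ldeg N d)%:R^-1 <= _).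
  by apply: ge0_ler_powR; rewrite ?invr_ge0 ?nnegrE ?exprn_ge0.
rewrite -powR_mulrn// -powRrM.
have t0 : 0 <= (k + N)%:R^-1 - (N%:R / (k + N)%:R + 1) * (d + N)%:R^-1 :> R.
  rewrite subr_ge0 ler_pdivrMr// [X in _ <= X]mulrC ler_pdivlMr// mulrDl divfK ?gt_eqF//.
  by rewrite mul1r -natrD ler_nat; lia.
apply: ler_powR_exp => //.
  by rewrite mulr_ge0 ?exprn_ge0// divr_ge0.
have -> : (k + N)%:R^-1 - (N%:R / (k + N)%:R + 1) * (d + N)%:R^-1
    = (d%:R / (k + N)%:R - 1) / (d + N)%:R :> R.
  have := lt0r_neq0 (kN_gt0 d); have := lt0r_neq0 (kN_gt0 k).
  rewrite !natrD => h1 h2; field.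
  by rewrite h1 h2.
have dq : d%:R / (k + N)%:R - 1 <= q%:R :> R.
  rewrite lerBlDr ler_pdivrMr// natr1 -natrM ler_nat.
  rewrite /q; have := ltn_ceil d (_ : 0 < k + N)%N.
  by rewrite addn_gt0 N_gt0 orbT => /(_ isT) /ltnW.
rewrite lE invf_div natrX.
have dN := kN_gt0 d.
have fd : 0 < ((d + N) ^_ N.+1)%:R :> R.
  by rewrite ltr0n ffact_gt0 -add1n leq_add2r.
have dk0 : 0 <= d%:R / (k + N)%:R - 1 :> R.
  by rewrite subr_ge0 ler_pdivlMr// mul1r ler_nat ltnW.
have -> : q%:R ^+ N.+1 * (N.+1`!%:R / (N%:R * ((d + N) ^_ N.+1)%:R))
    = N.+1`!%:R / N%:R * (q%:R ^+ N.+1 / ((d + N) ^_ N.+1)%:R) :> R.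
  by field; rewrite !gt_eqF.
rewrite exprMn exprVn.
rewrite ler_wpM2l ?divr_ge0// ler_pM ?exprn_ge0 ?invr_ge0 ?exprn_ge0//.
  by rewrite lerXn2r// nnegrE.
rewrite lef_pV2 ?posrE ?exprn_gt0// -natrX ler_nat.
exact: ffact_le_expn.
Qed.

Lemma root_limsup_cvg k :
  (a k `^ (N.+1`!%:R / N%:R *
     ((k + N)%:R^-1 - (N%:R / (k + N)%:R + 1) * (d + N)%:R^-1) ^+ N.+1))
    @[d --> \oo] --> a k `^ e k.
Proof.
apply: cvg_powR_exp => //.
have -> : e k = N.+1`!%:R / N%:R * ((k + N)%:R^-1 - (N%:R / (k + N)%:R + 1) * 0) ^+ N.+1.
  by rewrite mulr0 subr0 exprVn -mulrA -invfM.
apply: cvgM; first exact: cvg_cst.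
apply: (@cvg_comp _ _ _
    (fun d => (k + N)%:R^-1 - (N%:R / (k + N)%:R + 1) * (d + N)%:R^-1)
    (fun x => x ^+ N.+1)); last exact: exprn_continuous.
apply: cvgB; first exact: cvg_cst.
apply: cvgM; first exact: cvg_cst.
exact: cvg_inv_addn.
Qed.

Let L := inf (range (fun k => a k `^ e k)).

Let has_infA : has_inf (range (fun k => a k `^ e k)).
Proof.
split; first by exists (a 0 `^ e 0); exists 0%N.
by exists 0 => _ [k _ <-]; exact: powR_ge0.
Qed.

Let L01 : 0 <= L <= 1.
Proof.
apply/andP; split.
  by apply: lb_le_inf => [|_ [k _ <-]]; [exact: has_infA.1|exact: powR_ge0].
apply: le_trans (_ : a 0 `^ e 0 <= _).
  by apply: ge_inf; [exact: has_infA.2|exists 0%N].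
by rewrite -(powRr0 (a 0)) ler_powR_exp ?a01// ltW.
Qed.

(** The term of index [d] bounds the infimum [L]; it has exponent [e d] instead of [1 / ldeg N d].
    The product [e d * ldeg N d] is at least [(d / (d + N)) ^ N.+1], and [L <= 1] turns this into
    the lower bound. *)
Lemma root_liminf d : (0 < d)%N ->
  L `^ ((1 - N%:R * (d + N)%:R^-1) ^- N.+1) <= a d `^ (ldeg N d)%:R^-1.
Proof.
move=> d0; have Ld : L <= a d `^ e d by apply: ge_inf; [exact: has_infA.2|exists d].
have l0 := l_gt0 d0.
have -> : (ldeg N d)%:R^-1 = e d * (e d * (ldeg N d)%:R)^-1 :> R.
  by rewrite invfM mulrA divff ?mul1r// gt_eqF.
rewrite powRrM.
have dN := kN_gt0 d.
have fd : 0 < ((d + N) ^_ N.+1)%:R :> R.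
  by rewrite ltr0n ffact_gt0 -add1n leq_add2r.
have elE : e d * (ldeg N d)%:R = ((d + N) ^_ N.+1)%:R / (d + N)%:R ^+ N.+1.
  have simp (f x y z : R) : f != 0 -> x != 0 -> y != 0 -> f / (x * y) * (x * z / f) = z / y.
    by move=> *; field; apply/and3P.
  by rewrite lE /e simp ?expf_neq0 ?gt_eqF// ltr0n fact_gt0.
have el0 : 0 < e d * (ldeg N d)%:R by rewrite mulr_gt0.
apply: le_trans (_ : L `^ (e d * (ldeg N d)%:R)^-1 <= _); last first.
  by apply: ge0_ler_powR; rewrite ?nnegrE ?invr_ge0 ?powR_ge0 ?(ltW el0)//; case/andP: L01.
apply: ler_powR_exp => //; first by rewrite invr_ge0 ltW.
have tE : 1 - N%:R * (d + N)%:R^-1 = d%:R / (d + N)%:R :> R.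
  by move: dN; rewrite natrD => dN; field; rewrite gt_eqF.
have t0 : 0 < 1 - N%:R * (d + N)%:R^-1 :> R by rewrite tE divr_gt0// ltr0n.
rewrite lef_pV2 ?posrE ?exprn_gt0// elE tE exprMn exprVn ler_wpM2r ?invr_ge0 ?exprn_ge0//.
by rewrite -natrX ler_nat expn_le_ffact.
Qed.

Lemma root_liminf_cvg :
  (L `^ ((1 - N%:R * (d + N)%:R^-1) ^- N.+1)) @[d --> \oo] --> L.
Proof.
rewrite -[X in _ --> X]powRr1; last by case/andP: L01.
apply: cvg_powR_exp => //; first by case/andP: L01.
rewrite [X in _ --> X](_ : _ = (1 - N%:R * 0) ^- N.+1); last first.
  by rewrite mulr0 subr0 expr1n invr1.
apply: cvgV; first by rewrite mulr0 subr0 expr1n oner_neq0.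
apply: (@cvg_comp _ _ _ (fun d => 1 - N%:R * (d + N)%:R^-1 : R)
    (fun x : R => x ^+ N.+1)); last exact: exprn_continuous.
apply: cvgB; first exact: cvg_cst.
apply: cvgM; first exact: cvg_cst.
exact: cvg_inv_addn.
Qed.

Lemma root_cvg : (a d `^ (ldeg N d)%:R^-1) @[d --> \oo] --> L.
Proof.
apply/cvgrPdist_lt => eps eps0.
have [_ [k _ <-] ak] := inf_adherent eps0 has_infA.
have : \forall d \near \oo, L - eps < L `^ ((1 - N%:R * (d + N)%:R^-1) ^- N.+1).
  by apply: (cvgr_gt _ root_liminf_cvg); rewrite ltrBlDr ltrDl.
have := cvgr_lt _ (@root_limsup_cvg k) _ ak.
move=> hi lo; near=> d.
have kd : (k + N < d)%N by near: d; exact: nbhs_infty_gt.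
rewrite ltr_distlC; apply/andP; split.
  apply: lt_le_trans (root_liminf (leq_ltn_trans _ kd)) => //.
  by near: d.
apply: le_lt_trans (root_limsup kd) _.
by near: d; exact: hi.
Unshelve. all: by end_near. Qed.

End root_limit.

(** * Growth of [mdim] compared with [ldeg] *)

Lemma mdim_gt0 N d : (0 < mdim N d)%N.
Proof. by rewrite bin_gt0 leq_addl. Qed.

Lemma ldeg_mdim N d : (N.+1 * ldeg N d = N * (d * mdim N d))%N.
Proof.
rewrite /ldeg mulnCA; congr (_ * _)%N; case: d => [|d].
  by rewrite addn0 bin_small// muln0.
rewrite mul_bin_left -addnBAC// subnn add0n; congr (_ * _)%N.
by rewrite /mdim -[RHS]bin_sub ?leq_addl// addnK.
Qed.

Section root_ratio.
Variables (R : realType) (N : nat).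
Hypothesis N_gt0 : (0 < N)%N.

Let kappa : R := N.+1%:R / N%:R.

Lemma mdim_ldeg_ratio d : (0 < d)%N ->
  (mdim N d)%:R / (ldeg N d)%:R = kappa * d%:R^-1 :> R.
Proof.
move=> d0; have l0 : (ldeg N d)%:R != 0 :> R by rewrite pnatr_eq0 -lt0n ldeg_gt0.
have dn0 : d%:R != 0 :> R by rewrite pnatr_eq0 -lt0n.
have Nn0 : N%:R != 0 :> R by rewrite pnatr_eq0 -lt0n.
apply: (mulIf (mulf_neq0 l0 (mulf_neq0 Nn0 dn0))).
have E : N.+1%:R * (ldeg N d)%:R = N%:R * (d%:R * (mdim N d)%:R) :> R.
  by rewrite -!natrM ldeg_mdim.
move: l0 E; move: (ldeg N d)%:R (mdim N d)%:R => l m l0 E.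
transitivity (N%:R * (d%:R * m)); first by field.
by rewrite -E /kappa; field; exact/andP.
Qed.

Lemma mdim_ldeg_cvg0 : ((mdim N d)%:R / (ldeg N d)%:R : R) @[d --> \oo] --> (0 : R).
Proof.
rewrite -[X in _ --> X](mulr0 kappa) -(cvg_shiftn 1).
under eq_fun do rewrite addn1 mdim_ldeg_ratio//.
apply: cvgM; first exact: cvg_cst.
exact: cvg_harmonic.
Qed.

Lemma cst_root_cvg1 (c : R) : 0 < c ->
  (c `^ ((mdim N d)%:R / (ldeg N d)%:R)) @[d --> \oo] --> (1 : R).
Proof.
move=> c0; rewrite -[X in _ --> X](powRr0 c).
exact: cvg_powR_exp_gt0 c0 mdim_ldeg_cvg0.
Qed.

(** A crude bound that suffices to make [ln n / n] at most [2 / sqrt n]. *)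
Lemma ln_le_sqrt (x : R) : 0 < x -> ln x <= 2 * Num.sqrt x.
Proof.
move=> x0; have sx : 0 < Num.sqrt x by rewrite sqrtr_gt0.
have -> : ln x = 2 * ln (Num.sqrt x).
  by rewrite -{1}(sqr_sqrtr (ltW x0)) lnXn// mulr_natl.
by rewrite ler_pM2l// ltW// ln_sublinear.
Qed.

Lemma mdim_le d : (mdim N d <= (d + N) ^ N)%N.
Proof.
rewrite /mdim -bin_sub ?leq_addl// addnK addnC.
rewrite (@leq_trans ((d + N) ^_ N))//.
  by rewrite -bin_ffact leq_pmulr// fact_gt0.
exact: ffact_le_expn.
Qed.

Lemma mdim_root_cvg1 :
  ((mdim N d)%:R `^ ((mdim N d)%:R / (ldeg N d)%:R)) @[d --> \oo] --> (1 : R).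
Proof.
(* The factor [N] comes from [mdim N d <= (d + N) ^ N]; the 4 is a 2 from [ln_le_sqrt] times a 2
   from [d + N <= 2 * d]. *)
pose c := kappa * (N%:R * 4).
have s0 : Num.sqrt (d + N)%:R^-1 @[d --> \oo] --> (0 : R).
  rewrite -[X in _ --> X](@sqrtr0 R).
  apply: (@cvg_comp _ _ _ (fun d => (d + N)%:R^-1) Num.sqrt); last exact: sqrt_continuous.
  exact: cvg_inv_addn.
pose g d : R := expR (c * Num.sqrt (d + N)%:R^-1).
have gcvg : g d @[d --> \oo] --> (1 : R).
  rewrite -expR0 -[X in expR X](mulr0 c).
  apply: (@cvg_comp _ _ _ (fun d => c * Num.sqrt (d + N)%:R^-1) expR);
    last exact: continuous_expR.
  by apply: cvgM => //; exact: cvg_cst.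
apply: (squeeze_cvgr _ (cvg_cst (1 : R)) gcvg).
near=> d.
have d0 : (0 < d)%N by near: d; exact: nbhs_infty_gt.
have Nd : (N <= d)%N by near: d; exact: nbhs_infty_ge.
have m1 : 1 <= (mdim N d)%:R :> R by rewrite ler1n mdim_gt0.
have m0 : 0 < (mdim N d)%:R :> R by rewrite ltr0n mdim_gt0.
have n0 : 0 < (d + N)%:R :> R by rewrite ltr0n addn_gt0 d0.
have dr0 : 0 < d%:R :> R by rewrite ltr0n.
apply/andP; split.
  by rewrite /= -[leLHS](powRr0 (mdim N d)%:R) ler_powR// divr_ge0.
rewrite mdim_ldeg_ratio// /powR gt_eqF// /g /c ler_expR.
have kappa0 : 0 <= kappa by rewrite divr_ge0.
rewrite -[leLHS]mulrA -[leRHS]mulrA (ler_wpM2l kappa0)//.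
rewrite [leLHS]mulrC ler_pdivrMr//.
apply: le_trans (_ : N%:R * ln ((d + N)%:R : R) <= _).
  rewrite [leRHS]mulr_natl -lnXn// ler_ln ?posrE ?exprn_gt0//.
  by rewrite -natrX ler_nat mdim_le.
rewrite -!mulrA ler_wpM2l//.
apply: le_trans (ln_le_sqrt n0) _.
have sn0 : 0 < Num.sqrt ((d + N)%:R : R) by rewrite sqrtr_gt0.
rewrite sqrtrV ?(ltW n0)//.
have -> : 2 * Num.sqrt (d + N)%:R = 2 * (d + N)%:R / Num.sqrt (d + N)%:R :> R.
  by apply: (mulIf (lt0r_neq0 sn0)); rewrite divfK ?gt_eqF// -mulrA -expr2 sqr_sqrtr// ltW.
rewrite ler_pdivrMr// mulrA [leRHS]mulrAC divfK ?gt_eqF// natrD.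
have : N%:R <= d%:R :> R by rewrite ler_nat.
lra.
Unshelve. all: by end_near. Qed.

(** The bound [m! <= m ^ m] reduces this to [mdim_root_cvg1]. *)
Lemma fact_root_cvg1 :
  ((mdim N d)`!%:R `^ (ldeg N d)%:R^-1) @[d --> \oo] --> (1 : R).
Proof.
apply: (squeeze_cvgr _ (cvg_cst (1 : R)) mdim_root_cvg1).
near=> d.
have f1 : 1 <= (mdim N d)`!%:R :> R by rewrite ler1n fact_gt0.
have m0 : 0 <= (mdim N d)%:R :> R by [].
apply/andP; split.
  by rewrite /= -[leLHS](powRr0 (mdim N d)`!%:R) ler_powR ?invr_ge0.
rewrite powRrM powR_mulrn//; apply: ge0_ler_powR; rewrite ?invr_ge0 ?nnegrE ?exprn_ge0//.
rewrite -natrX ler_nat -ffactnn; move: (mdim N d) => m.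
exact: ffact_le_expn.
Unshelve. all: by end_near. Qed.

(** A factor [c ^ d] per point contributes the same constant for every [d > 0], because
    [d * mdim N d / ldeg N d] is exactly [kappa]. *)
Lemma powR_ldeg (c : R) d : (0 < d)%N -> 0 <= c ->
  (c ^+ (d * mdim N d)) `^ (ldeg N d)%:R^-1 = c `^ kappa.
Proof.
move=> d0 c0; rewrite -powR_mulrn// -powRrM natrM -mulrA mdim_ldeg_ratio//.
by rewrite mulrCA divff ?mulr1// pnatr_eq0 -lt0n.
Qed.

End root_ratio.

(** * Comparison of sequences, and the complex modulus *)

(* A strict factor [1 + t] with [t] arbitrary absorbs the [(1 + eps) ^ d] of the
   Bernstein-Markov inequality. *)
Lemma cvg_of_approx (R : realType) (x y b : nat -> R) (l : R) :
  x d @[d --> \oo] --> l -> b d @[d --> \oo] --> (1 : R) ->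
  0 <= l -> (forall d, 0 <= y d) ->
  (\forall d \near \oo, y d <= x d * b d) ->
  (forall t, 0 < t -> exists2 c : nat -> R, c d @[d --> \oo] --> (1 : R) &
     \forall d \near \oo, x d <= c d * (1 + t) * y d) ->
  y d @[d --> \oo] --> l.
Proof.
move=> xl b1 l0 y0 yx xy; apply/cvgrPdist_lt => eps eps0.
have l1 : 0 < l + 1 by rewrite ltr_wpDl.
(* With [t = eps / (l + 1)] one has [l * t < eps], hence [l - eps < l / (1 + t)]; the [+ 1] covers
   [l = 0]. *)
have t0 : 0 < eps / (l + 1) by rewrite divr_gt0.
have [c c1 xc] := xy _ t0.
have t1 : 0 < 1 + eps / (l + 1) by rewrite addr_gt0.
have hi : \forall d \near \oo, x d * b d < l + eps.
  apply: (@cvgr_lt _ _ _ _ _ (l * 1)); last by rewrite mulr1 ltrDl.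
  exact: cvgM.
have lo : \forall d \near \oo, l - eps < x d / (c d * (1 + eps / (l + 1))).
  apply: (@cvgr_gt _ _ _ _ _ (l / (1 * (1 + eps / (l + 1))))).
    apply: cvgM => //; apply: cvgV; first by rewrite mul1r gt_eqF.
    by apply: cvgM => //; exact: cvg_cst.
  rewrite mul1r ltr_pdivlMr// mulrDr mulr1 mulrBl.
  have -> : l * (eps / (l + 1)) = eps - eps / (l + 1).
    by field; rewrite gt_eqF.
  have : 0 < eps * (eps / (l + 1)) by rewrite mulr_gt0.
  lra.
have c0 : \forall d \near \oo, 0 < c d by apply: cvgr_gt c1 _ ltr01.
near=> d; rewrite ltr_distlC; apply/andP; split.
  have cd : 0 < c d by near: d.
  apply: (@lt_le_trans _ _ (x d / (c d * (1 + eps / (l + 1))))); first by near: d.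
  rewrite ler_pdivrMr ?mulr_gt0// [leRHS]mulrC; near: d; exact: xc.
apply: (@le_lt_trans _ _ (x d * b d)); near: d; [exact: yx|exact: hi].
Unshelve. all: by end_near. Qed.

Lemma cabs_ge0 (R : realType) (x : R[i]) : 0 <= cabs x.
Proof. by case: x => a b; rewrite sqrtr_ge0. Qed.

Lemma cabsX (R : realType) (x : R[i]) n : cabs (x ^+ n) = cabs x ^+ n.
Proof.
elim: n => [|n IH]; first by rewrite !expr0 ComplexField.Normc.normc1.
by rewrite !exprS ComplexField.Normc.normcM IH.
Qed.

Lemma cabs_prod (R : realType) I (r : seq I) (P : pred I) (F : I -> R[i]) :
  cabs (\prod_(i <- r | P i) F i) = \prod_(i <- r | P i) cabs (F i).
Proof.
apply: (big_morph _ (@ComplexField.Normc.normcM R)).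
exact: ComplexField.Normc.normc1.
Qed.

Lemma cabs_sum (R : realType) I (r : seq I) (P : pred I) (F : I -> R[i]) :
  cabs (\sum_(i <- r | P i) F i) <= \sum_(i <- r | P i) cabs (F i).
Proof.
elim/big_rec2: _ => [|i x y _ IH]; first by rewrite ComplexField.Normc.normc0.
by apply: le_trans (le_normcD (F i) y) _; rewrite lerD2l.
Qed.

Lemma cabs_le_dist (R : realType) (a b : R[i]) : cabs a <= cabs b + cabs (b - a).
Proof.
by have := le_normcD b (- (b - a)); rewrite normcN opprB addrCA subrr addr0.
Qed.

Lemma le_infM (R : realType) (S : set R) (x c : R) :
  S !=set0 -> 0 <= c -> (forall a, S a -> x <= a * c) -> x <= inf S * c.
Proof.
move=> S0; rewrite le_eqVlt => /predU1P[<-|c0] xS.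
  by have [a /xS] := S0; rewrite !mulr0.
rewrite -ler_pdivrMr//; apply: lb_le_inf => // a /xS.
by rewrite ler_pdivrMr.
Qed.

(** * Polynomials and Vandermonde determinants *)

Section evaluation.
Variables (R : realType) (N : nat).

Definition peval (p : mpoly N R[i]) (z : Cspace R N) : R[i] :=
  meval (fun k => z ord0 k : R[i]) p.

Lemma pevalE (s : seq (multinom N)) (p : mpoly N R[i]) z :
  uniq s -> {subset msupp p <= s} ->
  peval p z = \sum_(m <- s) mcoeff m p * \prod_k (z ord0 k : R[i]) ^+ fun_of_multinom m k.
Proof.
move=> us sub; rewrite /peval mevalE.
have pe : perm_eq (msupp p) [seq m <- s | m \in msupp p].
  apply: uniq_perm; rewrite ?msupp_uniq ?filter_uniq// => m.
  by rewrite mem_filter; case mp: (m \in msupp p) => //=; rewrite sub.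
rewrite (perm_big _ pe) big_filter [LHS]big_mkcond/=.
apply: eq_bigr => m _; case: ifPn => // mp.
by rewrite memN_msupp_eq0// mul0r.
Qed.

Lemma cabs_peval_le (B : R) (p : mpoly N R[i]) (z : Cspace R N) :
  (forall k, cabs (z ord0 k) <= B) ->
  cabs (peval p z) <= \sum_(m <- msupp p) cabs (mcoeff m p) * B ^+ mdeg m.
Proof.
move=> zB; rewrite /peval mevalE (le_trans (cabs_sum _ _ _))//.
apply: ler_sum => m _; rewrite ComplexField.Normc.normcM ler_wpM2l ?cabs_ge0//.
rewrite cabs_prod mdegE -prodrXr; apply: ler_prod => k _.
rewrite cabsX exprn_ge0 ?cabs_ge0//= lerXn2r ?nnegrE ?cabs_ge0//.
exact: le_trans (cabs_ge0 _) (zB k).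
Qed.

(** Points are indexed by functions instead of tuples: deleting a point is then composition with
    [lift], replacing one is [fun_upd]. *)
Definition vmx n (zeta : 'I_n -> Cspace R N) : 'M[R[i]]_n :=
  \matrix_(i < n, j < n) monom i (zeta j).

Definition fun_upd n (zeta : 'I_n -> Cspace R N) (j : 'I_n) z :=
  fun k => if k == j then z else zeta k.

(** The Vandermonde determinant as a polynomial in its [j]-th point, by cofactor expansion along
    column [j]. *)
Definition vdm_poly n (zeta : 'I_n -> Cspace R N) (j : 'I_n) : mpoly N R[i] :=
  \sum_(i < n) cofactor (vmx zeta) i j *: mpolyX _ (mindex N i).

Lemma peval_vdm_poly n (zeta : 'I_n -> Cspace R N) (j : 'I_n) z :
  peval (vdm_poly zeta j) z = \det (vmx (fun_upd zeta j z)).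
Proof.
rewrite /vdm_poly /peval raddf_sum/= (expand_det_col _ j).
apply: eq_bigr => i _; rewrite mevalZ mulrC; congr (_ * _).
  by rewrite mxE /fun_upd eqxx mevalX.
rewrite /cofactor; congr (_ * \det _); apply/matrixP => a b.
by rewrite !mxE /fun_upd eq_sym (negbTE (neq_lift _ _)).
Qed.

Hypothesis N_gt0 : (0 < N)%N.

Lemma vdm_poly_size d n (zeta : 'I_n -> Cspace R N) (j : 'I_n) :
  (n <= mdim N d)%N -> (mmeasure (@mdeg N) (vdm_poly zeta j) <= d.+1)%N.
Proof.
move=> nd; apply: (leq_trans (mmeasure_sum _ _ _ _)).
apply/bigmax_leqP => i _; apply: leq_trans (msizeZ_le _ _) _.
by rewrite msizeX ltnS (mdeg_mindex N_gt0)// (leq_trans _ nd).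
Qed.

Lemma mcoeff_vdm_poly d n (zeta : 'I_n -> Cspace R N) (j i : 'I_n) :
  (n <= mdim N d)%N -> mcoeff (mindex N i) (vdm_poly zeta j) = cofactor (vmx zeta) i j.
Proof.
move=> nd; rewrite /vdm_poly raddf_sum/= (bigD1 i)//= big1.
  by rewrite addr0 mcoeffZ mcoeffX eqxx mulr1.
move=> k ki; rewrite mcoeffZ mcoeffX.
case: eqP; last by rewrite mulr0.
move/(mindex_inj (d := d) N_gt0) => ki'; rewrite -val_eqE in ki.
by case/eqP: ki; apply: ki'; rewrite inE (leq_trans _ nd).
Qed.

Lemma msupp_vdm_poly n (zeta : 'I_n -> Cspace R N) (j : 'I_n) m :
  m \in msupp (vdm_poly zeta j) -> exists i : 'I_n, m = mindex N i.
Proof.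
rewrite mcoeff_msupp /vdm_poly raddf_sum/= => /eqP s0.
apply: contrapT => nm; apply: s0; apply: big1 => i _.
by rewrite mcoeffZ mcoeffX; case: eqP => [e|]; [case: nm; exists i|rewrite mulr0].
Qed.

(** The coefficient condition also excludes the zero polynomial, whose [mlead] is the zero
    multi-index by convention. *)
Definition monic_with_lead (m : multinom N) : set (mpoly N R[i]) :=
  [set p | mlead p = m /\ mcoeff m p = 1].

Lemma monic_with_leadX m : monic_with_lead m (mpolyX _ m).
Proof. by split; [exact: mleadXm|rewrite mcoeffX eqxx]. Qed.

Lemma monic_with_leadM m m' p p' : monic_with_lead m p -> monic_with_lead m' p' ->
  monic_with_lead (mnm_add m m') (p * p').
Proof.
move=> [<- pm] [<- pm'].
have neq0 q : mcoeff (mlead q) q = 1 -> q != 0.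
  by move=> q1; rewrite -mleadc_eq0 q1 oner_neq0.
by split; [apply: mleadM; exact: neq0|rewrite mleadcM pm pm' mulr1].
Qed.

Lemma peval_monic d n p z : (n < mdim N d)%N -> monic_with_lead (mindex N n) p ->
  peval p z = \sum_(i < n.+1) mcoeff (mindex N i) p * monom i z.
Proof.
move=> nd [lp _].
rewrite (@pevalE [seq mindex N i | i <- iota 0 n.+1]).
- by rewrite big_map -[iota 0 n.+1]/(index_iota 0 n.+1) big_mkord.
- rewrite map_inj_in_uniq ?iota_uniq// => i j; rewrite !mem_iota /= !add0n !ltnS => i1 j1.
  by apply: (mindex_inj (d := d) N_gt0); rewrite inE (leq_ltn_trans _ nd).
- move=> m /msupp_le_mlead; rewrite lp le_eqVlt => /predU1P[->|].
    by rewrite map_f// mem_iota add0n ltnS leqnn.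
  move=> /(lt_mindex N_gt0 nd)[j jn ->].
  by rewrite map_f// mem_iota /= add0n ltnS ltnW.
Qed.

(* Adding multiples of the previous rows replaces the last row by the values of p. *)
Lemma det_vmx_monic d n (zeta : 'I_n.+1 -> Cspace R N) p :
  (n < mdim N d)%N -> monic_with_lead (mindex N n) p ->
  \det (vmx zeta) =
    \sum_j peval p (zeta j) * ((-1) ^+ (n + j) * \det (vmx (zeta \o lift j))).
Proof.
move=> nd mp.
(* [L] is the identity except for its last row, which holds the coefficients of [p]; it is
   unitriangular because [p] is monic. *)
pose L : 'M[R[i]]_n.+1 :=
  \matrix_(i, j) (if i == ord_max then mcoeff (mindex N j) p else (i == j)%:R).
have detL : \det L = 1.
  rewrite det_trig.
    apply: big1 => i _; rewrite mxE; case: eqP => [->|_]; last by rewrite eqxx.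
    by case: mp.
  apply/is_trig_mxP => i j ij; rewrite mxE; case: eqP => [e|_].
    by move: ij; rewrite e ltnNge -ltnS ltn_ord.
  by rewrite (_ : i == j = false)//; apply/negP => /eqP e; rewrite e ltnn in ij.
have LE i j : (L *m vmx zeta) i j =
    if i == ord_max then peval p (zeta j) else monom i (zeta j).
  rewrite mxE; case: ifPn => [/eqP ->|im].
    rewrite (peval_monic _ nd mp); apply: eq_bigr => k _.
    by rewrite !mxE eqxx.
  rewrite (bigD1 i)//= big1 ?addr0 => [|k ki]; rewrite !mxE (negbTE im).
    by rewrite eqxx mul1r.
  by rewrite eq_sym (negbTE ki) mul0r.
have -> : \det (vmx zeta) = \det (L *m vmx zeta) by rewrite det_mulmx detL mul1r.
(* Deleting the last row and column [j] leaves the Vandermonde matrix of the other points. *)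
rewrite (expand_det_row _ ord_max).
apply: eq_bigr => j _; rewrite LE eqxx /cofactor; congr (_ * (_ * \det _)).
apply/matrixP => a b; rewrite mxE mxE LE.
rewrite eq_sym (negbTE (neq_lift _ _)) mxE /=; congr (monom _ _).
by rewrite /bump leqNgt ltn_ord.
Qed.

End evaluation.

(** * Chebyshev constants and maximal weighted determinants *)

Section chebyshev.
Variables (R : realType) (N : nat) (E : set (Cspace R N)) (w : Cspace R N -> R).
Variables A B : R.
Hypothesis N_gt0 : (0 < N)%N.
Hypothesis E_neq0 : E !=set0.
Hypothesis w_ge0 : forall z, E z -> 0 <= w z.
Hypothesis w_leA : forall z, E z -> w z <= A.
Hypothesis E_leB : forall z k, E z -> cabs (z ord0 k : R[i]) <= B.
Hypothesis A_ge1 : 1 <= A.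
Hypothesis B_ge1 : 1 <= B.

Definition weighted_norm d (p : mpoly N R[i]) : R :=
  sup [set w z ^+ d * cabs (peval p z) | z in E].

(** This is Y(d, m). The weight exponent [d] is separate from the degree of [m], since all monomials
    of degree at most [d] carry the same weight. *)
Definition chebyshev_const d (m : multinom N) : R :=
  inf [set weighted_norm d p | p in @monic_with_lead R N m].

Let A0 : 0 <= A. Proof. exact: le_trans A_ge1. Qed.

Lemma weighted_value_ge0 d p z : E z -> 0 <= w z ^+ d * cabs (peval p z).
Proof. by move=> Ez; rewrite mulr_ge0 ?exprn_ge0 ?cabs_ge0 ?w_ge0. Qed.

Lemma has_sup_weighted d p : has_sup [set w z ^+ d * cabs (peval p z) | z in E].
Proof.
split; first by have [z Ez] := E_neq0; eexists; exists z.
exists (A ^+ d * \sum_(m <- msupp p) cabs (mcoeff m p) * B ^+ mdeg m) => _ [z Ez <-].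
rewrite ler_pM ?exprn_ge0 ?cabs_ge0 ?w_ge0//.
  by rewrite lerXn2r ?nnegrE ?w_ge0 ?w_leA.
by apply: cabs_peval_le => k; exact: E_leB.
Qed.

Lemma le_weighted_norm d p z : E z -> w z ^+ d * cabs (peval p z) <= weighted_norm d p.
Proof. by move=> Ez; apply: sup_upper_bound; [exact: has_sup_weighted|exists z]. Qed.

Lemma weighted_norm_ge0 d p : 0 <= weighted_norm d p.
Proof.
have [z Ez] := E_neq0.
exact: le_trans (weighted_value_ge0 d p Ez) (le_weighted_norm d p Ez).
Qed.

Lemma weighted_norm_le d p x :
  (forall z, E z -> w z ^+ d * cabs (peval p z) <= x) -> weighted_norm d p <= x.
Proof.
move=> h; apply: ge_sup; first by case: (has_sup_weighted d p).
by move=> _ [z Ez <-]; exact: h.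
Qed.

Lemma chebyshev_neq0 d m : [set weighted_norm d p | p in @monic_with_lead R N m] !=set0.
Proof.
exists (weighted_norm d (mpolyX _ m)); exists (mpolyX _ m) => //.
exact: monic_with_leadX.
Qed.

Lemma has_inf_chebyshev d m : has_inf [set weighted_norm d p | p in @monic_with_lead R N m].
Proof.
split; first exact: chebyshev_neq0.
by exists 0 => _ [p _ <-]; exact: weighted_norm_ge0.
Qed.

Lemma chebyshev_const_ge0 d m : 0 <= chebyshev_const d m.
Proof.
apply: lb_le_inf; first exact: chebyshev_neq0.
by move=> _ [p _ <-]; exact: weighted_norm_ge0.
Qed.

Lemma chebyshev_const_le d m p : monic_with_lead m p ->
  chebyshev_const d m <= weighted_norm d p.
Proof. by move=> mp; apply: ge_inf; [exact: (has_inf_chebyshev d m).2|exists p]. Qed.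

(** The monomial itself is a competitor, and [B >= 1] allows its degree to be raised to [d]. *)
Lemma chebyshev_const_bound d m : (mdeg m <= d)%N -> chebyshev_const d m <= (A * B) ^+ d.
Proof.
move=> md; apply: le_trans (chebyshev_const_le d (@monic_with_leadX R N m)) _.
apply: weighted_norm_le => z Ez; rewrite exprMn.
rewrite ler_pM ?exprn_ge0 ?cabs_ge0 ?w_ge0//.
  by rewrite lerXn2r ?nnegrE ?w_ge0 ?w_leA.
rewrite /peval mevalX cabs_prod.
apply: (@le_trans _ _ (B ^+ mdeg m)); last by rewrite ler_weXn2l.
rewrite mdegE -prodrXr; apply: ler_prod => k _.
rewrite cabsX exprn_ge0 ?cabs_ge0//= lerXn2r ?nnegrE ?cabs_ge0 ?E_leB//.
exact: le_trans B_ge1.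
Qed.

(** The product of two competitors competes for the sum of the multi-indices; the infima are then
    taken one factor at a time. *)
Lemma chebyshev_const_submul d d' m m' :
  chebyshev_const (d + d') (mnm_add m m') <= chebyshev_const d m * chebyshev_const d' m'.
Proof.
apply: le_infM; [exact: chebyshev_neq0|exact: chebyshev_const_ge0|move=> _ [p mp <-]].
rewrite mulrC; apply: le_infM;
  [exact: chebyshev_neq0|exact: weighted_norm_ge0|move=> _ [p' mp' <-]].
apply: le_trans (chebyshev_const_le _ (monic_with_leadM mp mp')) _.
apply: weighted_norm_le => z Ez.
rewrite /peval mevalM ComplexField.Normc.normcM exprD mulrACA mulrC.
by rewrite ler_pM ?weighted_value_ge0 ?le_weighted_norm.
Qed.

(** The number [n] of points is independent of [d], so that induction on [n] can keep the weight
    fixed. *)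
Definition weighted_det d n (zeta : 'I_n -> Cspace R N) : R :=
  cabs (\det (vmx zeta)) * \prod_(j < n) w (zeta j) ^+ d.

Definition sup_weighted_det d n : R :=
  sup [set weighted_det d zeta
      | zeta in [set zeta : 'I_n -> Cspace R N | forall j, E (zeta j)]].

Lemma weighted_det_ge0 d n (zeta : 'I_n -> Cspace R N) :
  (forall j, E (zeta j)) -> 0 <= weighted_det d zeta.
Proof.
by move=> Ez; rewrite mulr_ge0 ?cabs_ge0 ?prodr_ge0// => j _; rewrite exprn_ge0 ?w_ge0.
Qed.

(** In the expansion of [det_vmx_monic], the weight of point [j] goes with the value of [p] there,
    the other weights with the minor. *)
Lemma weighted_det_expand d e n (zeta : 'I_n.+1 -> Cspace R N) p :
  (n < mdim N e)%N -> monic_with_lead (mindex N n) p -> (forall j, E (zeta j)) ->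
  weighted_det d zeta <= \sum_j weighted_norm d p * weighted_det d (zeta \o lift j).
Proof.
move=> ne mp Ez; rewrite /weighted_det (det_vmx_monic N_gt0 zeta ne mp).
have w0 : 0 <= \prod_(j < n.+1) w (zeta j) ^+ d.
  by rewrite prodr_ge0// => j _; rewrite exprn_ge0 ?w_ge0.
apply: le_trans (ler_wpM2r w0 (cabs_sum _ _ _)) _.
rewrite mulr_suml; apply: ler_sum => j _.
rewrite !ComplexField.Normc.normcM (bigD1_ord j)//=.
have -> : cabs ((-1) ^+ (n + j) : R[i]) = 1.
  by rewrite cabsX normcN ComplexField.Normc.normc1 expr1n.
rewrite mul1r mulrACA [cabs (peval _ _) * _]mulrC.
apply: ler_wpM2r; last exact: le_weighted_norm.
by apply: (@weighted_det_ge0 d n (zeta \o lift j)) => k; exact: Ez.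
Qed.

(** Boundedness follows by induction on [n] from the expansion, with the monomial itself as [p]. *)
Lemma has_sup_weighted_det d e n : (n <= mdim N e)%N ->
  has_sup [set weighted_det d zeta
          | zeta in [set zeta : 'I_n -> Cspace R N | forall j, E (zeta j)]].
Proof.
move=> ne; split.
  by have [z Ez] := E_neq0; eexists; exists (fun=> z) => // j.
elim: n ne => [|n IH] ne.
  exists 1 => _ [zeta _ <-].
  by rewrite /weighted_det det_mx00 ComplexField.Normc.normc1 big_ord0 mulr1.
have [C bC] := IH (ltnW ne).
exists (\sum_(j < n.+1) weighted_norm d (mpolyX _ (mindex N n)) * C) => _ [zeta Ez <-].
apply: le_trans (weighted_det_expand d ne (@monic_with_leadX R N _) Ez) _.
apply: ler_sum => j _; rewrite ler_wpM2l ?weighted_norm_ge0//.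
by apply: bC; exists (zeta \o lift j) => // k; exact: Ez.
Qed.

Lemma le_sup_weighted_det d e n zeta : (n <= mdim N e)%N -> (forall j : 'I_n, E (zeta j)) ->
  weighted_det d zeta <= sup_weighted_det d n.
Proof.
by move=> ne Ez; apply: sup_upper_bound; [exact: has_sup_weighted_det ne|exists zeta].
Qed.

Lemma sup_weighted_det_le d e n x : (n <= mdim N e)%N ->
  (forall zeta, (forall j : 'I_n, E (zeta j)) -> weighted_det d zeta <= x) ->
  sup_weighted_det d n <= x.
Proof.
move=> ne h; apply: ge_sup; first by case: (has_sup_weighted_det d ne).
by move=> _ [z Ez <-]; exact: h.
Qed.

Lemma sup_weighted_det_ge0 d e n : (n <= mdim N e)%N -> 0 <= sup_weighted_det d n.
Proof.
move=> ne; have [z Ez] := E_neq0.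
apply: le_trans (le_sup_weighted_det d (zeta := fun=> z) ne _) => //.
exact: weighted_det_ge0.
Qed.

Lemma sup_weighted_detS_le d e n : (n < mdim N e)%N ->
  sup_weighted_det d n.+1
    <= n.+1%:R * chebyshev_const d (mindex N n) * sup_weighted_det d n.
Proof.
move=> ne; apply: (sup_weighted_det_le ne) => zeta Ez.
rewrite [_ * chebyshev_const _ _]mulrC -mulrA; apply: le_infM.
- exact: chebyshev_neq0.
- by rewrite mulr_ge0// (sup_weighted_det_ge0 d (ltnW ne)).
move=> _ [p mp <-]; apply: le_trans (weighted_det_expand d ne mp Ez) _.
rewrite mulrCA mulr_natl -[X in _ *+ X](card_ord n.+1) -sumr_const.
apply: ler_sum => j _; rewrite ler_wpM2l ?weighted_norm_ge0//.
by apply: (le_sup_weighted_det d (ltnW ne)) => k; exact: Ez.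
Qed.

Lemma sup_weighted_detS_ge d e n : (n < mdim N e)%N ->
  chebyshev_const d (mindex N n) * sup_weighted_det d n <= sup_weighted_det d n.+1.
Proof.
move=> ne; rewrite mulrC.
have S0 := sup_weighted_det_ge0 d ne.
have c0 := chebyshev_const_ge0 d (mindex N n).
move: (c0); rewrite le_eqVlt => /predU1P[<-|c_gt0]; first by rewrite mulr0.
rewrite -ler_pdivlMr//; apply: (sup_weighted_det_le (ltnW ne)) => zeta Ez.
rewrite ler_pdivlMr// mulrC.
have [det0|detn0] := eqVneq (\det (vmx zeta)) 0.
  by rewrite /weighted_det det0 ComplexField.Normc.normc0 mul0r mulr0.
have [z0 Ez0] := E_neq0.
(* The point [z0] only fills the last slot below: the cofactors along the last column do not depend
   on it. *)
pose zeta1 z (k : 'I_n.+1) := if unlift ord_max k is Some i then zeta i else z.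
have zeta1_lift z : zeta1 z \o lift ord_max = zeta.
  by apply/funext => i /=; rewrite /zeta1 liftK.
have zeta1_max z : zeta1 z ord_max = z by rewrite /zeta1 unlift_none.
have zeta1_upd z : fun_upd (zeta1 z0) ord_max z = zeta1 z.
  apply/funext => k; rewrite /fun_upd /zeta1.
  by case: unliftP => [i ->|->]; rewrite ?eqxx// eq_sym (negbTE (neq_lift _ _)).
(* The determinant as a function of an additional last point, divided by the
   determinant of the points [zeta], is monic. *)
pose q := vdm_poly (zeta1 z0) ord_max.
have qn : mcoeff (mindex N n) q = \det (vmx zeta).
  rewrite (mcoeff_vdm_poly N_gt0 (zeta1 z0) ord_max ord_max ne) /cofactor.
  rewrite -signr_odd oddD addbb expr0 mul1r; congr (\det _).
  apply/matrixP => i j; rewrite !mxE -[zeta in RHS](zeta1_lift z0) /=.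
  by rewrite /bump leqNgt ltn_ord.
pose p := (\det (vmx zeta))^-1 *: q.
have pn : mcoeff (mindex N n) p = 1 by rewrite mcoeffZ qn mulVf.
have mp : monic_with_lead (mindex N n) p.
  (* The support of [q] lies among the first [n + 1] monomials, the greatest of which is
     [mindex N n]. *)
  split=> //; apply/eqP; rewrite eq_le; apply/andP; split; last first.
    by apply: msupp_le_mlead; rewrite mcoeff_msupp pn oner_eq0.
  have p0 : p != 0 by apply/eqP => p0; move/eqP: pn; rewrite p0 mcoeff0 eq_sym oner_eq0.
  have := mlead_supp p0; rewrite mcoeff_msupp mcoeffZ mulf_eq0 negb_or => /andP[_].
  rewrite -mcoeff_msupp => /msupp_vdm_poly[i ->].
  rewrite !(mindexE N_gt0 (d := e)) ?(leq_trans (ltn_ord i))//.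
  apply: (sorted_leq_nth le_trans le_refl _ (graded_seq_sorted N e)).
  - by rewrite inE size_graded_seq (leq_trans (ltn_ord i)).
  - by rewrite inE size_graded_seq.
  - by rewrite -ltnS.
(* The weighted value of [p] at [z] times the weighted determinant of [zeta] is the weighted
   determinant of [zeta] with [z] appended. *)
apply: (@le_trans _ _ (weighted_norm d p * weighted_det d zeta)).
  by rewrite ler_wpM2r ?weighted_det_ge0 ?chebyshev_const_le.
have wd0 := weighted_det_ge0 d Ez.
move: (wd0); rewrite le_eqVlt => /predU1P[<-|wd_gt0]; first by rewrite mulr0.
rewrite -ler_pdivlMr//; apply: weighted_norm_le => z Ez'; rewrite ler_pdivlMr//.
have Ezeta1 j : E (zeta1 z j) by rewrite /zeta1; case: unlift.
apply: le_trans (le_sup_weighted_det d ne Ezeta1).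
rewrite /weighted_det (bigD1_ord ord_max)//= zeta1_max.
under [X in _ <= _ * (_ * X)]eq_bigr do rewrite /zeta1 liftK.
have -> : peval p z = (\det (vmx zeta))^-1 * \det (vmx (zeta1 z)).
  by rewrite /peval mevalZ -/(peval q z) peval_vdm_poly zeta1_upd.
have dn0 : cabs (\det (vmx zeta)) != 0.
  by apply: contra_neq detn0; exact: ComplexField.Normc.eq0_normc.
rewrite ComplexField.Normc.normcM ComplexField.Normc.normcV.
by rewrite le_eqVlt; apply/orP; left; apply/eqP; field.
Qed.

Lemma sup_weighted_det0 d : sup_weighted_det d 0 = 1.
Proof.
have v0 (zeta : 'I_0 -> Cspace R N) : weighted_det d zeta = 1 :> R.
  by rewrite /weighted_det det_mx00 ComplexField.Normc.normc1 big_ord0 mulr1.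
rewrite /sup_weighted_det -[RHS]sup1; congr sup; apply/seteqP; split => x /=.
  by move=> [zeta _ <-].
have [z Ez] := E_neq0.
by move=> ->; exists (fun=> z).
Qed.

Lemma sup_weighted_det_bounds d n : (n <= mdim N d)%N ->
  \prod_(i < n) chebyshev_const d (mindex N i) <= sup_weighted_det d n
    <= n`!%:R * \prod_(i < n) chebyshev_const d (mindex N i).
Proof.
elim: n => [|n IH] nd; first by rewrite !big_ord0 sup_weighted_det0 mulr1 lexx.
have /andP[lo hi] := IH (ltnW nd); rewrite !big_ord_recr/=; apply/andP; split.
  apply: le_trans (sup_weighted_detS_ge d nd).
  by rewrite mulrC ler_wpM2l ?chebyshev_const_ge0.
apply: le_trans (sup_weighted_detS_le d nd) _.
rewrite factS natrM [X in _ <= _ * X]mulrC mulrACA ler_wpM2l//.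
by rewrite mulr_ge0 ?chebyshev_const_ge0.
Qed.

Let C := A * B.
Let C_gt0 : 0 < C.
Proof. by rewrite mulr_gt0 ?(lt_le_trans _ A_ge1) ?(lt_le_trans _ B_ge1). Qed.

(** The value 0 for degrees above [d] makes [0 <= y <= 1] hold for all multi-indices, as
    [prod_submul_le] requires. *)
Let y d (m : multinom N) : R :=
  if (mdeg m <= d)%N then chebyshev_const d m / C ^+ d else 0.

Let a d := \prod_(m : bmultinom N d.+1) y d m.

Let prod_cheb d :
  \prod_(i < mdim N d) chebyshev_const d (mindex N i) = C ^+ (d * mdim N d) * a d.
Proof.
rewrite (prod_mindex d (chebyshev_const d) N_gt0) exprM -card_bmultinom.
rewrite -prodr_const -big_split/=.
apply: eq_bigr => m _; rewrite /y -ltnS bmdeg mulrC divfK//.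
by rewrite expf_neq0// gt_eqF.
Qed.

Let y01 d m : 0 <= y d m <= 1.
Proof.
rewrite /y; case: ifPn => md; last by rewrite lexx ler01.
rewrite divr_ge0 ?chebyshev_const_ge0 ?exprn_ge0 ?(ltW C_gt0)//=.
by rewrite ler_pdivrMr ?exprn_gt0// mul1r chebyshev_const_bound.
Qed.

Let y_submul d d' m m' : (mdeg m <= d)%N -> (mdeg m' <= d')%N ->
  y (d + d') (mnm_add m m') <= y d m * y d' m'.
Proof.
move=> md md'; rewrite /y md md' mdegD leq_add// mulrACA -invfM -exprD.
by rewrite ler_wpM2r ?chebyshev_const_submul// invr_ge0 exprn_ge0 ?ltW.
Qed.

Let a01 d : 0 <= a d <= 1.
Proof.
apply/andP; split; first by apply: prodr_ge0 => m _; case/andP: (y01 d m).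
by apply: prodr_ile1 => m _; exact: y01.
Qed.

(** The normalisation by powers of [C] contributes the constant [K], the product [a d] has a root
    limit by [root_cvg], and the factorial is squeezed away. *)
Lemma sup_weighted_det_root_cvg : exists2 l : R, 0 <= l &
  (sup_weighted_det d (mdim N d) `^ (ldeg N d)%:R^-1) @[d --> \oo] --> l.
Proof.
have acvg := root_cvg N_gt0 a01 (prod_submul_le y01 y_submul).
set L := inf _ in acvg; pose K := C `^ (N.+1%:R / N%:R).
have L0 : 0 <= L.
  by apply: lb_le_inf; [eexists; exists 0%N|move=> _ [k _ <-]; exact: powR_ge0].
have KLcvg : (K * a d `^ (ldeg N d)%:R^-1) @[d --> \oo] --> K * L.
  by apply: cvgM => //; exact: cvg_cst.
exists (K * L); first by rewrite mulr_ge0 ?powR_ge0.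
have up : ((mdim N d)`!%:R `^ (ldeg N d)%:R^-1 * (K * a d `^ (ldeg N d)%:R^-1))
    @[d --> \oo] --> K * L.
  rewrite -[X in _ --> X]mul1r; apply: cvgM => //; exact: fact_root_cvg1.
apply: (squeeze_cvgr _ KLcvg up); near=> d.
have d0 : (0 < d)%N by near: d; exact: nbhs_infty_gt.
have /andP[lo hi] := sup_weighted_det_bounds (leqnn (mdim N d)).
have a0 : 0 <= a d by case/andP: (a01 d).
have S0 := sup_weighted_det_ge0 d (leqnn (mdim N d)).
have P0 : 0 <= C ^+ (d * mdim N d) by rewrite exprn_ge0 ?ltW.
have -> : K * a d `^ (ldeg N d)%:R^-1 = (C ^+ (d * mdim N d) * a d) `^ (ldeg N d)%:R^-1.
  by rewrite powRM// powR_ldeg// ltW.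
rewrite -powRM ?mulr_ge0// -prod_cheb.
apply/andP; split; apply: ge0_ler_powR;
  rewrite ?nnegrE ?invr_ge0 ?mulr_ge0 ?prodr_ge0// => *;
  exact: chebyshev_const_ge0.
Unshelve. all: by end_near. Qed.

Lemma max_weighted_VDME d : max_weighted_VDM E w d = sup_weighted_det d (mdim N d).
Proof.
congr sup; apply/seteqP; split => x /= [lam Elam <-].
  exists (tnth lam) => //.
exists [tuple lam i | i < mdim N d]; first by move=> j; rewrite tnth_mktuple.
rewrite /weighted_VDM /VDM /weighted_det /vmx; congr (cabs (\det _) * _).
  by apply/matrixP => i j; rewrite !mxE tnth_mktuple.
by apply: eq_bigr => j _; rewrite tnth_mktuple.
Qed.

End chebyshev.

(** * Integrals and iterated integrals of nonnegative functions *)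

(* The integral of a nonnegative function is defined as a supremum over simple
   functions, so these inequalities hold even for nonmeasurable integrands; this
   avoids any joint measurability argument for the iterated integrals below. *)
Section integral_without_measurability.
Local Open Scope ereal_scope.
Context d (T : measurableType d) (R : realType) (mu : {measure set T -> \bar R}).
Import HBNNSimple.

Lemma ge0_le_integral_nm (D : set T) (f g : T -> \bar R) :
  (forall x, D x -> 0 <= f x) -> (forall x, D x -> f x <= g x) ->
  \int[mu]_(x in D) f x <= \int[mu]_(x in D) g x.
Proof.
move=> f0 fg; rewrite !ge0_integralE//; last first.
  by move=> x Dx; exact: le_trans (f0 x Dx) (fg x Dx).
apply: ereal_sup_le => _ [h hf <-]; exists h => // x.
apply: le_trans (hf x) _; rewrite !patchE; case: ifPn => // /set_mem.
exact: fg.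
Qed.

Lemma ge0_integralZl_nm (D : set T) (f : T -> \bar R) (k : R) :
  (0 <= k)%R -> (forall x, D x -> 0 <= f x) ->
  k%:E * \int[mu]_(x in D) f x <= \int[mu]_(x in D) (k%:E * f x).
Proof.
rewrite le_eqVlt => /predU1P[<-|k0] f0.
  by rewrite mul0e integral_ge0// => x _; rewrite mul0e.
rewrite -lee_pdivlMl// !ge0_integralE//; last first.
  by move=> x Dx; apply: mule_ge0; [rewrite lee_fin ltW|exact: f0].
apply: ge_ereal_sup => _ [h hf <-]; rewrite lee_pdivlMl// -sintegralrM.
apply: ereal_sup_ubound; exists (scale_nnsfun h (ltW k0)) => // x /=.
rewrite EFinM patchE; have := hf x; rewrite patchE; case: ifPn => _ hx.
  by rewrite lee_wpmul2l// lee_fin ltW.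
by have := lee_wpmul2l (_ : 0 <= k%:E) hx; rewrite mule0; apply; rewrite lee_fin ltW.
Qed.

(** Since [D] is an arbitrary set, the zero extension of [f] is compared with a constant on the
    whole space. *)
Lemma integral_le_cst (D : set T) (f : T -> \bar R) (K b : R) : (0 <= K)%R ->
  mu setT <= b%:E -> (forall x, D x -> 0 <= f x <= K%:E) ->
  \int[mu]_(x in D) f x <= (K * b)%:E.
Proof.
move=> K0 mub f0K; rewrite integral_mkcond.
apply: (@le_trans _ _ (\int[mu]_x (cst K%:E x))).
  apply: ge0_le_integral_nm => x _; rewrite patchE.
    by case: ifPn => // /set_mem /f0K /andP[].
  by case: ifPn => [/set_mem /f0K /andP[]//|_]; rewrite lee_fin.
by rewrite integral_cst// EFinM lee_wpmul2l// lee_fin.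
Qed.

End integral_without_measurability.

Section iterated.
Variables (R : realType) (N : nat) (mu : {finite_measure set (borelC R N) -> \bar R}).
Variable E : set (Cspace R N).
Local Open Scope ereal_scope.

Definition tuple_upd n (t : n.-tuple (Cspace R N)) (j : 'I_n) x : n.-tuple (Cspace R N) :=
  [tuple fun_upd (tnth t) j x i | i < n].

Lemma iterated_integral_ge0 n (F : n.-tuple (Cspace R N) -> \bar R) :
  (forall t, (forall j, E (tnth t j)) -> 0 <= F t) -> 0 <= iterated_integral mu E F.
Proof.
elim: n F => [|n IH] F F0 /=; first by apply: F0 => -[].
apply: integral_ge0 => x Ex; apply: IH => t Et; apply: F0 => j.
by case: (unliftP ord0 j) => [i ->|->]; rewrite ?tnthS ?tnth0.
Qed.

Lemma iterated_integral_le n (F : n.-tuple (Cspace R N) -> \bar R) (K b : R) :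
  (0 <= K)%R -> (0 <= b)%R -> mu setT <= b%:E ->
  (forall t, (forall j, E (tnth t j)) -> 0 <= F t <= K%:E) ->
  iterated_integral mu E F <= (K * b ^+ n)%:E.
Proof.
move=> K0 b0 mub; elim: n F => [|n IH] F FK /=.
  have nil_in (j : 'I_0) : E (tnth [tuple] j) by case: j.
  by rewrite mulr1; case/andP: (FK [tuple] nil_in).
rewrite exprSr mulrA; apply: integral_le_cst => //; first by rewrite mulr_ge0 ?exprn_ge0.
move=> x Ex.
have Ext t : (forall j, E (tnth t j)) ->
    forall j, E (tnth [tuple of (x : Cspace R N) :: t] j).
  by move=> Et j; case: (unliftP ord0 j) => [i ->|->]; rewrite ?tnthS ?tnth0.
apply/andP; split.
  by apply: iterated_integral_ge0 => t /Ext /FK /andP[].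
by apply: IH => t /Ext /FK.
Qed.

(** One factor [k] pays for integrating out the first point; the induction hypothesis then applies
    to the remaining points with the first one frozen. *)
Lemma iterated_integral_ge n (F : n.-tuple (Cspace R N) -> \bar R) (k : R) :
  (0 <= k)%R ->
  (forall t, (forall j, E (tnth t j)) -> 0 <= F t) ->
  (forall t j, (forall j, E (tnth t j)) ->
     k%:E * F t <= \int[mu]_(x in E) F (tuple_upd t j x)) ->
  forall t, (forall j, E (tnth t j)) -> (k ^+ n)%:E * F t <= iterated_integral mu E F.
Proof.
move=> k0; elim: n F => [|n IH] F F0 Fk t Et /=.
  by rewrite mul1e [t]tuple0.
have Econs x (s : n.-tuple _) : E x -> (forall j, E (tnth s j)) ->
    forall j, E (tnth [tuple of (x : Cspace R N) :: s] j).
  by move=> Ex Es j; case: (unliftP ord0 j) => [i ->|->]; rewrite ?tnthS ?tnth0.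
case/tupleP: t Et => x s Es.
have Ex : E x by have := Es ord0; rewrite tnth0.
have Es' j : E (tnth s j) by have := Es (lift ord0 j); rewrite tnthS.
have upd0 y : tuple_upd [tuple of x :: s] ord0 y = [tuple of y :: s].
  apply: eq_from_tnth => j; rewrite tnth_mktuple /fun_upd.
  by case: (unliftP ord0 j) => [i ->|->]; rewrite ?eqxx ?tnthS ?tnth0.
have updS y (u : n.-tuple _) j z :
    tuple_upd [tuple of y :: u] (lift ord0 j) z = [tuple of y :: tuple_upd u j z].
  apply: eq_from_tnth => i; rewrite tnth_mktuple /fun_upd.
  case: (unliftP ord0 i) => [i' ->|->];
    by rewrite ?tnthS ?tnth0 ?tnth_mktuple /fun_upd ?(inj_eq lift_inj).
rewrite exprSr EFinM -muleA.
apply: (@le_trans _ _ ((k ^+ n)%:E * \int[mu]_(y in E) F [tuple of (y : Cspace R N) :: s])).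
  rewrite lee_wpmul2l ?lee_fin ?exprn_ge0//.
  have := Fk _ ord0 Es; congr (_ <= _).
  by apply: eq_integral => y _; rewrite upd0.
apply: (le_trans (ge0_integralZl_nm _ _ _)); rewrite ?exprn_ge0//.
  by move=> y Ey; apply/F0/Econs.
apply: ge0_le_integral_nm => y Ey.
  by rewrite mule_ge0 ?lee_fin ?exprn_ge0//; apply/F0/Econs.
apply: (IH (fun u => F [tuple of (y : Cspace R N) :: u])) => //.
  by move=> u Eu; apply/F0/Econs.
move=> u j Eu; have := Fk [tuple of y :: u] (lift ord0 j) (Econs _ _ Ey Eu).
by congr (_ <= _); apply: eq_integral => z _; rewrite updS.
Qed.

End iterated.

(** * Bounds from compactness *)

(** A local bound holds for all large constants, so the near-covering form of compactness along
    [+oo] yields one constant for all of [E]. *)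
Lemma compact_locally_bounded (R : realType) (T : topologicalType) (E : set T)
    (f : T -> R) :
  compact E ->
  (forall x, E x -> exists c, \forall y \near within E (nbhs x), f y <= c) ->
  exists C, forall x, E x -> f x <= C.
Proof.
move=> /compact_near_coveringP cE loc.
have := cE R (pinfty_nbhs R) (fun c x => E x -> f x <= c) _.
have h : forall x, E x -> \forall x' \near x & i \near +oo, E x' -> f x' <= i.
  move=> x Ex; have [c nc] := loc x Ex.
  exists ([set y | E y -> f y <= c], [set i | c <= i]); first split => //=.
    exact: nbhs_pinfty_ge (num_real c).
  by move=> [y i] /= [fy ci] Ey; exact: le_trans (fy Ey) ci.
move=> /(_ _ h) near_C.
have [C hC] := filter_ex near_C.
by exists C => x Ex; exact: hC.
Qed.

Section compactness.
Variables (R : realType) (N : nat) (E : set (Cspace R N)) (w : Cspace R N -> R).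

(** This is what makes a nonpluripolar set nonempty. *)
Lemma pluripolar_set0 : pluripolar (set0 : set (Cspace R N)).
Proof.
exists (fun=> 0%E); split => //; last by exists 0.
split => //.
  by move=> x _ c c0; near=> y.
by move=> a b; rewrite integral0 mule0.
Unshelve. all: by end_near. Qed.

Lemma usc_compact_bounded : compact E -> upper_semicontinuous_on E (EFin \o w) ->
  exists A, forall z, E z -> w z <= A.
Proof.
move=> cE usc; apply: compact_locally_bounded cE _ => x Ex; exists (w x + 1).
have := usc x Ex (w x + 1); rewrite lte_fin ltrDl ltr01 => /(_ isT).
by apply: filterS => y; rewrite lte_fin => /ltW.
Qed.

Lemma compact_coord_bounded : compact E ->
  exists B, forall z k, E z -> cabs (z ord0 k : R[i]) <= B.
Proof.
move=> cE.
have bk k : exists B, forall z, E z -> cabs (z ord0 k : R[i]) <= B.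
  apply: (compact_locally_bounded cE) => x Ex; exists (cabs (x ord0 k : R[i]) + 1).
  have := @cvgr_dist_lt _ _ _ _ _ _ _ (@coord_continuous R[i] 1 N ord0 k x) 1 ltr01.
  move=> /(_ (nbhs_filter x)); apply: filterS => y yx _.
  have yx1 : cabs (x ord0 k - y ord0 k : R[i]) < 1 by move: yx; rewrite -ltcR.
  by rewrite (le_trans (cabs_le_dist _ (x ord0 k)))// lerD2l ltW.
have [B hB] := choice bk.
exists (\sum_k Num.max 0 (B k)) => z k Ez.
rewrite (bigD1 k)//= (le_trans (hB k z Ez))// ler_wpDr ?le_max ?lexx ?orbT//.
by rewrite sumr_ge0// => i _; rewrite le_max lexx.
Qed.

End compactness.

(** * Comparison of [Zint] with the maximal weighted determinant *)

Section integrals_of_vandermonde.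
Variables (R : realType) (N : nat) (E : set (Cspace R N)) (w : Cspace R N -> R).
Variable mu : {finite_measure set (borelC R N) -> \bar R}.
Hypothesis N_gt0 : (0 < N)%N.
Hypothesis w_ge0 : forall z, E z -> 0 <= w z.

Let v d p (z : Cspace R N) : R := w z ^+ d * cabs (peval p z).

Let v_ge0 d p z : E z -> 0 <= v d p z.
Proof. by move=> Ez; rewrite mulr_ge0 ?exprn_ge0 ?w_ge0 ?cabs_ge0. Qed.

(** Squaring turns the norm into an integral that can be iterated; replacing [M] by [Num.max M 1]
    makes the constant invertible. *)
Lemma bernstein_markov_sqr : bernstein_markov E w mu ->
  forall eps, 0 < eps -> exists2 C : R, 0 < C &
    forall d (p : mpoly N R[i]), (mmeasure (@mdeg N) p <= d.+1)%N ->
    forall z, E z ->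
      (((C * (1 + eps) ^+ d) ^- 2)%:E * (v d p z ^+ 2)%:E
        <= \int[mu]_(x in E) (v d p x ^+ 2)%:E)%E.
Proof.
move=> bm eps eps0; have [M bmM] := bm _ eps0.
exists (Num.max M 1); first by rewrite lt_max ltr01 orbT.
move=> d p sp z Ez; set c := Num.max M 1 * (1 + eps) ^+ d.
have e1 : 0 < 1 + eps by rewrite addr_gt0.
have c0 : 0 < c by rewrite mulr_gt0 ?exprn_gt0// lt_max ltr01 orbT.
have vz : ((v d p z)%:E <= c%:E * 'N[mu]_2%:E[(fun z => (v d p z)%:E) \_ E])%E.
  apply: (@le_trans _ _ (ereal_sup [set (v d p x)%:E | x in E])).
    by apply: ereal_sup_ubound; exists z.
  apply: (le_trans (bmM d p sp)); rewrite lee_wpmul2r ?Lnorm_ge0// lee_fin.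
  by rewrite ler_wpM2r ?exprn_ge0 ?(ltW e1)// le_max lexx.
have L0 := @Lnorm_ge0 _ _ R mu 2%:E ((fun z => (v d p z)%:E) \_ E).
have sqr : ((v d p z ^+ 2)%:E <= (c ^+ 2)%:E * \int[mu]_(x in E) (v d p x ^+ 2)%:E)%E.
  have -> : (\int[mu]_(x in E) (v d p x ^+ 2)%:E
      = 'N[mu]_2%:E[(fun z => (v d p z)%:E) \_ E] `^ 2)%E.
    rewrite poweR_Lnorm// [LHS]integral_mkcond; apply: eq_integral => x _.
    rewrite !patchE; case: ifPn => [/set_mem Ex|_].
      by rewrite abse_EFin poweR_EFin ger0_norm ?v_ge0// powR_mulrn ?v_ge0.
    by rewrite abse0 poweR_EFin powR0.
  have -> : ((c ^+ 2)%:E = c%:E `^ 2)%E by rewrite poweR_EFin powR_mulrn// ltW.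
  rewrite -poweRM// ?lee_fin ?(ltW c0)//.
  have -> : ((v d p z ^+ 2)%:E = (v d p z)%:E `^ 2)%E.
    by rewrite poweR_EFin powR_mulrn// v_ge0.
  apply: gt0_ler_poweR => //; rewrite in_itv /= leey andbT.
    by rewrite lee_fin v_ge0.
  by rewrite mule_ge0// lee_fin ltW.
by rewrite lee_pdivrMl ?exprn_gt0.
Qed.

Let F d (t : (mdim N d).-tuple (Cspace R N)) : \bar R :=
  (cabs (VDM t) ^+ 2 * \prod_(j < mdim N d) w (tnth t j) ^+ (2 * d)%N)%:E.

Let FE d t : @F d t = (weighted_det w d (tnth t) ^+ 2)%:E.
Proof.
rewrite /F /weighted_det exprMn -prodrXl; congr (_ * _)%:E.
by apply: eq_bigr => j _; rewrite -exprM mulnC.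
Qed.

Let F_ge0 d t : (0 <= @F d t)%E.
Proof. by rewrite FE lee_fin sqr_ge0. Qed.

(** As a function of one point, the weighted determinant is a weighted polynomial times a constant,
    so Bernstein-Markov applies to it. *)
Lemma weighted_det_upd d (t : (mdim N d).-tuple (Cspace R N)) j z :
  weighted_det w d (tnth (tuple_upd t j z)) =
  v d (vdm_poly (tnth t) j) z * \prod_(i | i != j) w (tnth t i) ^+ d.
Proof.
have -> : tnth (tuple_upd t j z) = fun_upd (tnth t) j z.
  by apply/funext => i; rewrite tnth_mktuple.
rewrite /weighted_det /v peval_vdm_poly (bigD1 j)//=.
rewrite {2}/fun_upd eqxx mulrA [cabs _ * _]mulrC.
by congr (_ * _); apply: eq_bigr => i ij; rewrite /fun_upd (negbTE ij).
Qed.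

Lemma Zint_ge (c : R) d :
  (forall p, (mmeasure (@mdeg N) p <= d.+1)%N -> forall z, E z ->
    ((c ^- 2)%:E * (v d p z ^+ 2)%:E <= \int[mu]_(x in E) (v d p x ^+ 2)%:E)%E) ->
  forall zeta : 'I_(mdim N d) -> Cspace R N, (forall j, E (zeta j)) ->
  (((c ^- 2) ^+ mdim N d * weighted_det w d zeta ^+ 2)%:E <= Zint E w mu d)%E.
Proof.
move=> bm zeta Ez; pose t := [tuple zeta i | i < mdim N d].
have tz : tnth t = zeta by apply/funext => i; rewrite tnth_mktuple.
rewrite -tz EFinM -FE; apply: iterated_integral_ge.
- by rewrite invr_ge0 sqr_ge0.
- by move=> u _; exact: F_ge0.
- move=> {t tz zeta Ez} t j Et.
  (* Viewing [t] as its own update at [j] puts both sides in the form of a weighted polynomial in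
     the [j]-th point. *)
  have upd_id : tuple_upd t j (tnth t j) = t.
    by apply: eq_from_tnth => i; rewrite tnth_mktuple /fun_upd; case: eqP => [->|].
  set P := \prod_(i | i != j) w (tnth t i) ^+ d.
  have FP z : F (tuple_upd t j z) = ((P ^+ 2)%:E * (v d (vdm_poly (tnth t) j) z ^+ 2)%:E)%E.
    by rewrite FE weighted_det_upd exprMn mulrC.
  rewrite -{1}upd_id FP muleCA.
  apply: (@le_trans _ _ ((P ^+ 2)%:E *
      \int[mu]_(x in E) (v d (vdm_poly (tnth t) j) x ^+ 2)%:E)%E).
    rewrite lee_wpmul2l ?lee_fin ?sqr_ge0// bm//.
    by apply: vdm_poly_size => //; exact: leqnn.
  apply: (le_trans (ge0_integralZl_nm _ _ _)); rewrite ?sqr_ge0//.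
    by move=> x _; rewrite lee_fin sqr_ge0.
  by rewrite le_eqVlt; apply/orP; left; apply/eqP; apply: eq_integral => z _; rewrite FP.
- by move=> j; rewrite tz.
Qed.

Lemma Zint_le (S b : R) d : 0 <= b -> (mu setT <= b%:E)%E ->
  (forall zeta : 'I_(mdim N d) -> Cspace R N, (forall j, E (zeta j)) ->
     weighted_det w d zeta <= S) ->
  (Zint E w mu d <= (S ^+ 2 * b ^+ mdim N d)%:E)%E.
Proof.
move=> b0 mub wS; apply: iterated_integral_le => //; first exact: sqr_ge0.
move=> t Et; rewrite F_ge0/= -/(F t) FE lee_fin.
have wd0 : 0 <= weighted_det w d (tnth t) by exact: (weighted_det_ge0 w_ge0 d Et).
have wdS := wS _ Et.
by rewrite lerXn2r ?nnegrE// (le_trans wd0 wdS).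
Qed.

Lemma Zint_ge0 d : (0 <= Zint E w mu d)%E.
Proof. by apply: iterated_integral_ge0 => t _; exact: F_ge0. Qed.

End integrals_of_vandermonde.

(** * Convergence of the roots of [Zint] *)

Theorem theorem3p2 (R : realType) (N : nat) (N_gt0 : (0 < N)%N)
    (E : set (Cspace R N)) (w : Cspace R N -> R)
    (mu : {finite_measure set (borelC R N) -> \bar R}) :
  compact E -> ~ pluripolar E ->
  admissible_weight E w ->
  measure_support mu `<=` E ->
  bernstein_markov E w mu ->
  (Zint E w mu d `^ ((2 * ldeg N d)%:R^-1))%E @[d --> \oo]
    --> (weighted_transfinite_diameter E w)%:E.
Proof.
move=> cE Enp [w_ge0 w_usc _] _ bm.
have E_neq0 : E !=set0.
  by apply/set0P/negP => /eqP E0; apply: Enp; rewrite E0; exact: pluripolar_set0.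
have [A' w_leA'] := usc_compact_bounded cE w_usc.
have [B' E_leB'] := compact_coord_bounded cE.
pose A := Num.max 1 A'; pose B := Num.max 1 B'.
have A1 : 1 <= A by rewrite le_max lexx.
have B1 : 1 <= B by rewrite le_max lexx.
have w_leA z : E z -> w z <= A by move=> Ez; rewrite le_max w_leA' ?orbT.
have E_leB z k : E z -> cabs (z ord0 k) <= B by move=> Ez; rewrite le_max E_leB' ?orbT.
have [l l0 Vl] := sup_weighted_det_root_cvg N_gt0 E_neq0 w_ge0 w_leA E_leB A1 B1.
set V := fun d => sup_weighted_det E w d (mdim N d).
have V_ge d (zeta : 'I_(mdim N d) -> Cspace R N) :
    (forall j, E (zeta j)) -> weighted_det w d zeta <= V d.
  move=> Ez.
  exact: (le_sup_weighted_det N_gt0 E_neq0 w_ge0 w_leA E_leB A1 d (leqnn (mdim N d)) Ez).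
have V_le d x : (forall zeta : 'I_(mdim N d) -> Cspace R N,
    (forall j, E (zeta j)) -> weighted_det w d zeta <= x) -> V d <= x.
  exact: (sup_weighted_det_le N_gt0 E_neq0 w_ge0 w_leA E_leB A1 (leqnn (mdim N d))).
have V0 d : 0 <= V d.
  exact: (sup_weighted_det_ge0 N_gt0 E_neq0 w_ge0 w_leA E_leB A1 d (leqnn (mdim N d))).
(* The convergence [Vl] is what identifies the value of [lim]. *)
have -> : weighted_transfinite_diameter E w = l.
  rewrite /weighted_transfinite_diameter; under eq_fun do rewrite max_weighted_VDME.
  exact: cvg_lim Vl.
(* With [b >= 1], the exponent [mdim N d / (2 * ldeg N d)] can be enlarged to
   [mdim N d / ldeg N d]. *)
pose b := Num.max 1 (fine (mu setT)).
have b1 : 1 <= b by rewrite le_max lexx.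
have b0 : 0 <= b by exact: le_trans b1.
have mub : (mu setT <= b%:E)%E.
  by rewrite -[mu setT]fineK ?fin_num_measure// lee_fin le_max lexx orbT.
have Z_le d := Zint_le w_ge0 b0 mub (@V_ge d).
have Z_ge0 d : (0 <= Zint E w mu d)%E by exact: Zint_ge0.
pose Z d := fine (Zint E w mu d).
have ZE d : Zint E w mu d = (Z d)%:E.
  by rewrite fineK// ge0_fin_numE// (le_lt_trans (Z_le d)) ?ltry.
have Z0 d : 0 <= Z d by rewrite -lee_fin -ZE.
under eq_fun do rewrite ZE poweR_EFin.
apply: cvg_EFin; first by near=> d.
apply: (cvg_of_approx Vl (cst_root_cvg1 N_gt0 (lt_le_trans ltr01 b1)) l0).
- by move=> d; exact: powR_ge0.
- near=> d; rewrite /=.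
  have ZV : Z d <= V d ^+ 2 * b ^+ mdim N d by rewrite -lee_fin -ZE.
  apply: (@le_trans _ _ ((V d ^+ 2 * b ^+ mdim N d) `^ ((2 * ldeg N d)%:R^-1))).
    by apply: ge0_ler_powR; rewrite ?nnegrE ?invr_ge0 ?mulr_ge0 ?exprn_ge0.
  have E2 : (2 * ldeg N d)%:R^-1 = 2^-1 / (ldeg N d)%:R :> R by rewrite natrM invfM.
  have -> : (V d ^+ 2 * b ^+ mdim N d) `^ ((2 * ldeg N d)%:R^-1)
      = V d `^ (ldeg N d)%:R^-1 * b `^ ((mdim N d)%:R * (2^-1 / (ldeg N d)%:R)).
    rewrite powRM ?exprn_ge0// -!powR_mulrn// -!powRrM E2.
    by rewrite [2 * _]mulrA divff ?mul1r// pnatr_eq0.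
  rewrite ler_wpM2l ?powR_ge0// ler_powR// ler_wpM2l// ler_piMl ?invr_ge0//.
  by rewrite invf_le1// ler1n.
- move=> t t0.
  pose kappa : R := N.+1%:R / N%:R.
  have kappa0 : 0 < kappa by rewrite divr_gt0 ?ltr0n.
  (* By [powR_ldeg], the Bernstein-Markov factors contribute [1 + eps] to the power [kappa]; this
     choice makes that equal to [1 + t]. *)
  pose eps := (1 + t) `^ kappa^-1 - 1.
  have eps0 : 0 < eps.
    have one : 1 `^ kappa^-1 = 1 :> R by rewrite powR1.
    rewrite subr_gt0 -[ltLHS]one gt0_ltr_powR ?nnegrE ?invr_gt0 ?addr_ge0 ?(ltW t0)//.
    by rewrite ltrDl.
  have epsE : (1 + eps) `^ kappa = 1 + t.
    by rewrite addrC subrK -powRrM mulVf ?gt_eqF// powRr1// addr_ge0 ?ltW.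
  have [C C0 bmC] := bernstein_markov_sqr w_ge0 bm eps0.
  exists (fun d => C `^ ((mdim N d)%:R / (ldeg N d)%:R)); first exact: cst_root_cvg1.
  near=> d.
  have d0 : (0 < d)%N by near: d; exact: nbhs_infty_gt.
  have e1 : 0 < 1 + eps by rewrite addr_gt0.
  set c := C * (1 + eps) ^+ d.
  have c0 : 0 < c by apply: mulr_gt0 => //; exact: exprn_gt0.
  have VZ : V d <= c ^+ mdim N d * Num.sqrt (Z d).
    apply: V_le => zeta Ez.
    have := Zint_ge N_gt0 (c := c) (bmC d) Ez.
    rewrite ZE lee_fin exprVn -ler_pdivlMl ?invr_gt0 ?exprn_gt0// invrK => h.
    rewrite -[leLHS]ger0_norm ?(weighted_det_ge0 w_ge0)// -sqrtr_sqr.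
    rewrite (le_trans (ler_wsqrtr h))// sqrtrM ?exprn_ge0 ?(ltW c0)//.
    by rewrite exprAC sqrtr_sqr ger0_norm// exprn_ge0 ?ltW.
  apply: (@le_trans _ _ ((c ^+ mdim N d * Num.sqrt (Z d)) `^ ((ldeg N d)%:R^-1))).
    apply: ge0_ler_powR VZ; [by rewrite invr_ge0|exact: V0|].
    by rewrite nnegrE mulr_ge0 ?exprn_ge0 ?sqrtr_ge0 ?(ltW c0).
  rewrite powRM ?exprn_ge0 ?sqrtr_ge0 ?(ltW c0)//.
  (* The square root of [Z d] turns the root of order [ldeg N d] into one of order
     [2 * ldeg N d]. *)
  rewrite -powR12_sqrt// -powRrM -invfM -natrM.
  rewrite /c exprMn powRM ?exprn_ge0 ?(ltW C0) ?(ltW e1)//.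
  rewrite -exprM powR_ldeg ?(ltW e1)// epsE.
  by rewrite -powR_mulrn ?(ltW C0)// -powRrM.
Unshelve. all: by end_near. Qed.
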